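(* Let $n\in\mathbb{N}$, $n\ge2$; let $d_j\in\mathbb{N}$, $s_j\ge0$ for $1\le j\le n$, and $d=d_1+\cdots+d_n$; let $1\le p_j,q\le\infty$ and $\theta_j\ge0$ for $0\le j\le n$, with $p_0\ne q$ and $\sum_{j=0}^n\theta_j=1$. Assume $$d_j\left(\sum_{l=0}^n\frac{\theta_l}{p_l}-\frac1q\right)=\theta_js_j\qquad\text{for all }1\le j\le n,$$ and $(\theta_0,q)=(0,\infty)$. If $1<p_{j_0}<\infty$ and $\theta_{j_0}>0$ for some $1\le j_0\le n$, then there is no constant $C<\infty$ such that $$\|u\|_{L^q(\mathbb{R}^d)}\le C\,\|u\|_{L^{p_0}(\mathbb{R}^d)}^{\theta_0}\prod_{j=1}^n\|D_{x_j}^{s_j}u\|_{L^{p_j}(\mathbb{R}^d)}^{\theta_j}\qquad\text{for all }u\in\mathcal{S}(\mathbb{R}^d).$$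
   Context: Write $x=(x_1,\dots,x_n)\in\mathbb{R}^{d_1}\oplus\cdots\oplus\mathbb{R}^{d_n}=\mathbb{R}^d$ and $\xi=(\xi_1,\dots,\xi_n)$ for the dual variable. $\mathscr{F}$ is the Fourier transform on $\mathbb{R}^d$, $\mathscr{F}f(\xi)=(2\pi)^{-d/2}\int f(x)e^{-ix\cdot\xi}dx$, and $D_{x_j}^{s_j}=\mathscr{F}^{-1}|\xi_j|^{s_j}\mathscr{F}$. $\mathcal{S}$ denotes the Schwartz space; $1/\infty=0$. *)

(* Defs.v *)
From HB Require Import structures.
From mathcomp Require Import all_boot all_order all_algebra.
From mathcomp Require Import complex.
From mathcomp Require Import all_classical all_reals all_analysis.
Import Order.TTheory GRing.Theory Num.Theory.
Import numFieldNormedType.Exports.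

Set Implicit Arguments.
Unset Strict Implicit.
Unset Printing Implicit Defensive.

Local Open Scope classical_set_scope.
Local Open Scope ring_scope.
Local Open Scope complex_scope.

(* The library equips [N.-tuple T] with the product sigma-algebra but provides
   no Lebesgue measure on it; it is built here as an iterated product,
   transported along (a, t) |-> a :: t. *)

Section lebesgue_cons.
Context {R : realType} (N : nat).

Definition cons_pair (x : measurableTypeR R * N.-tuple (measurableTypeR R)) :
  N.+1.-tuple (measurableTypeR R) := [tuple of x.1 :: x.2].

Lemma measurable_cons_pair : measurable_fun [set: _] cons_pair.
Proof. exact: (@measurable_cons _ _ _ _ fst N snd). Qed.

Variable mu : {sigma_finite_measure set (N.-tuple (measurableTypeR R)) -> \bar R}.

Definition lebesgue_cons : set (N.+1.-tuple (measurableTypeR R)) -> \bar R :=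
  pushforward (@lebesgue_measure R \x mu)%E cons_pair.

Let lebesgue_cons0 : lebesgue_cons set0 = 0%E.
Proof. by rewrite /lebesgue_cons /pushforward preimage_set0 measure0. Qed.

Let lebesgue_cons_ge0 A : (0 <= lebesgue_cons A)%E.
Proof. by rewrite /lebesgue_cons /pushforward measure_ge0. Qed.

Let lebesgue_cons_sigma_additive : semi_sigma_additive lebesgue_cons.
Proof.
move=> F mF tF mUF; rewrite /lebesgue_cons /pushforward preimage_bigcup.
apply: measure_semi_sigma_additive.
- by move=> n; rewrite -[X in measurable X]setTI; exact: measurable_cons_pair.
- apply/trivIsetP => /= i j _ _ ij; rewrite -preimage_setI.
  by move/trivIsetP : tF => /(_ _ _ _ _ ij) ->//; rewrite preimage_set0.
- by rewrite -preimage_bigcup -[X in measurable X]setTI;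
    exact: measurable_cons_pair.
Qed.

HB.instance Definition _ := isMeasure.Build _ _ _ lebesgue_cons
  lebesgue_cons0 lebesgue_cons_ge0 lebesgue_cons_sigma_additive.

Let lebesgue_cons_sigma_finite : sigma_finite setT lebesgue_cons.
Proof.
have /sigma_finiteP[F [TF ndF Foo]] := sigma_finiteT (@lebesgue_measure R).
have /sigma_finiteP[G [TG ndG Goo]] := sigma_finiteT mu.
pose uncons (t : N.+1.-tuple (measurableTypeR R)) :
  measurableTypeR R * N.-tuple (measurableTypeR R) :=
  (tnth t ord0, [tuple of behead t]).
have consK : cancel cons_pair uncons.
  by move=> [a t]; congr (_, _); apply/val_inj.
have muncons : measurable_fun setT uncons.
  apply: measurable_fun_pair; [exact: measurable_tnth|exact: measurable_behead].
exists (fun n => uncons @^-1` (F n `*` G n)).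
  rewrite -preimage_bigcup; apply/esym; rewrite -subTset => t _.
  have [k _ Fk] : (\bigcup_k F k) (uncons t).1 by rewrite -TF.
  have [l _ Gl] : (\bigcup_k G k) (uncons t).2 by rewrite -TG.
  exists (maxn k l) => //; split.
    by move: Fk; exact/subsetPset/ndF/leq_maxl.
  by move: Gl; exact/subsetPset/ndG/leq_maxr.
move=> n; have [mF Fn] := Foo n; have [mG Gn] := Goo n.
have mFG : measurable (F n `*` G n) by exact: measurableX.
split; first by rewrite -[X in measurable X]setTI; exact: muncons.
rewrite /lebesgue_cons /pushforward.
rewrite (_ : cons_pair @^-1` _ = F n `*` G n).
  by rewrite product_measure1E// lte_mul_pinfty// ge0_fin_numE.
rewrite -comp_preimage (_ : uncons \o cons_pair = id) ?preimage_id//.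
by apply/funext => x; exact: consK.
Qed.

HB.instance Definition _ := Measure_isSigmaFinite.Build _ _ _ lebesgue_cons
  lebesgue_cons_sigma_finite.

End lebesgue_cons.

Fixpoint lebesgue_tuple (R : realType) (N : nat) :
    {sigma_finite_measure set (N.-tuple (measurableTypeR R)) -> \bar R} :=
  match N with
  | 0 => (\d_[tuple])%E
  | N'.+1 => lebesgue_cons (lebesgue_tuple R N')
  end.

Section integration.
Context {R : realType} {N : nat}.

Definition row_of_tuple (t : N.-tuple R) : 'rV[R]_N := \row_i tnth t i.

Definition integral_rV (f : 'rV[R]_N -> R) : R :=
  (\int[lebesgue_tuple R N]_t f (row_of_tuple t))%R.

Definition cintegral_rV (f : 'rV[R]_N -> R[i]) : R[i] :=
  integral_rV (fun x => complex.Re (f x)) +i*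
  integral_rV (fun x => complex.Im (f x)).

Definition Lp_norm (p : \bar R) (f : 'rV[R]_N -> R[i]) : \bar R :=
  Lnorm (lebesgue_tuple R N) p (fun t => (Normc.normc (f (row_of_tuple t)))%:E).

End integration.

Section fourier.
Context {R : realType}.

Definition dotp N (x y : 'rV[R]_N) : R := \sum_(i < N) x 0 i * y 0 i.

(* The norm that the library puts on 'rV[R]_N is the sup norm. *)
Definition euclid N (x : 'rV[R]_N) : R := Num.sqrt (dotp x x).

Definition expi (a : R) : R[i] := cos a +i* sin a.

Definition fourier_cst (N : nat) : R[i] := ((2 * pi) `^ (- (N%:R / 2)))%:C.

Definition fourier N (f : 'rV[R]_N -> R[i]) (xi : 'rV[R]_N) : R[i] :=
  fourier_cst N * cintegral_rV (fun x => f x * expi (- dotp x xi)).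

Definition fourier_inv N (g : 'rV[R]_N -> R[i]) (x : 'rV[R]_N) : R[i] :=
  fourier_cst N * cintegral_rV (fun xi => g xi * expi (dotp x xi)).

(* [submxrow xi j] is the block xi_j of xi = (xi_1, ..., xi_n).
   For s = 0 the multiplier is 1 everywhere, as [0 `^ 0 = 1]. *)
Definition fracD n (d : 'I_n -> nat) (j : 'I_n) (s : R)
    (u : 'rV[R]_(\sum_(k < n) d k) -> R[i]) :
    'rV[R]_(\sum_(k < n) d k) -> R[i] :=
  fourier_inv (fun xi => (euclid (submxrow xi j) `^ s)%:C * fourier u xi).

End fourier.

Section schwartz.
Context {R : realType} {N : nat}.

(* [partials [:: i1; ...; ik] f] is d_i1 (... (d_ik f)); for smooth f the order
   is irrelevant, so lists play the role of multi-indices. *)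
Definition partials (b : seq 'I_N) (f : 'rV[R]_N -> R) : 'rV[R]_N -> R :=
  foldr (fun i (g : 'rV[R]_N -> R) (x : 'rV[R]_N) => 'D_(delta_mx 0 i) g x) f b.

Definition smooth (f : 'rV[R]_N -> R) : Prop :=
  forall b : seq 'I_N, continuous (partials b f) /\
    forall (i : 'I_N) (x : 'rV[R]_N), derivable (partials b f) x (delta_mx 0 i).

Definition schwartz_real (f : 'rV[R]_N -> R) : Prop :=
  smooth f /\
  forall (a : 'I_N -> nat) (b : seq 'I_N), exists M : R,
    forall x : 'rV[R]_N, `|(\prod_(i < N) x 0 i ^+ a i) * partials b f x| <= M.

Definition schwartz (u : 'rV[R]_N -> R[i]) : Prop :=
  schwartz_real (fun x => complex.Re (u x)) /\
  schwartz_real (fun x => complex.Im (u x)).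

End schwartz.

(* Main.v *)
Require Import Defs.
From HB Require Import structures.
From mathcomp Require Import all_boot all_order all_algebra.
From mathcomp Require Import complex.
From mathcomp Require Import all_classical all_reals all_analysis.
From mathcomp Require Import measurable_realfun ess_sup_inf lebesgue_integral_under.
From mathcomp Require Import ring lra.
Import Order.TTheory GRing.Theory Num.Theory.
Import numFieldNormedType.Exports.

(** Under the hypotheses the sum alpha of the theta_l / p_l is positive, so
    d_j alpha = theta_j s_j makes every theta_j and s_j positive and says that
    both sides of the inequality scale alike under independent dilations of the
    n blocks.  Among these there is a one-parameter group, x_j |-> lambda_j x_j
    with lambda_j = exp (t / (p_j s_j)), whose Jacobian is exp t and which
    preserves each norm |D_{x_j}^{s_j} u|_{p_j} separately.  Let delta be its
    element at t = 1 and let u_K be the sum over k < K of the Gaussians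
    exp (- |delta^k x|^2 / 2).

    All K Gaussians equal 1 at the origin, so |u_K|_oo >= K / 2
    ([Lp_norm_gaussian_sum_ge]).  The derivative D_{x_j}^{s_j} u_K is a sum of
    pieces exp (k / p_j) psi_j (delta^k x), where psi_j is D_{x_j}^{s_j} of the
    standard Gaussian.  If psi_j is bounded and integrable then the pieces live
    at different heights on sets of different sizes, and they add up like
    functions with disjoint supports: the L^p norm is O(K^(1/p)) if p is finite,
    and trivially O(K) if p is infinite ([Lnorm_lacunary_le]).  Hence the right
    side of the inequality is O(K^e) with e the theta-average of exponents that
    are at most 1; the exponent 1 / p_{j_0} is smaller than 1 and has positive
    weight, so e < 1 and the inequality fails for large K.

    It remains to bound psi_j, the inverse Fourier transform of
    |xi_j|^s exp (- |xi|^2 / 2), in L^1 and in L^oo for an arbitrary real s > 0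
    ([fractional_gaussian_bound]).  The symbol need not be smooth at
    xi_j = 0, so the decay of its transform is read off a formula instead of being
    gained by integrations by parts.  With y = |xi_j|^2 / 2, an
    integer M > s / 2 and kappa = M - s / 2, the power y^(s/2) is a constant
    times the integral over r of exp (kappa r) y^M exp (- e^r y)
    ([subordination]).  After exchanging integrals ([fubini_fractional_gaussian])
    one needs the transform of y^M exp (- v y) for v = 1 + e^r.  It is, up to
    sign, the M-th derivative in v of the transform of exp (- v y), which is
    v^(- d_j / 2) exp (- z / (2 v)) with z = |x_j|^2; so it is a polynomial in
    z / v times v^(- d_j / 2 - M) exp (- z / (2 v)) ([block_integralE]).  Each of
    these functions has L^1 norm O(v^-M), and exp (kappa r) v^-M is integrable
    in r.

    The estimates only involve real integrals: the integrals of g(t) cos(x.t + u)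
    with an arbitrary phase u contain the real part (u = 0) and the imaginary
    part (u = pi/2 or - pi/2) of a Fourier integral, and they are stable under
    integration in one variable at a time, which makes the induction on the
    dimension immediate. *)

Local Open Scope classical_set_scope.
Local Open Scope ring_scope.

(** * Exponential decay, Gaussian integrals, integrals of derivatives *)

(** With n = m + 1, the inequality 1 + z <= exp z at z = e (1 + y) / n bounds
    1 + y by (n / e) exp (e (1 + y) / n); raise this to the power n. *)
Lemma expR_beats_power (R : realType) (n : nat) (e : R) : 0 < e ->
  exists2 C : R, 0 < C & forall y : R, 0 <= y -> (1 + y) ^+ n * expR (- (e * y)) <= C.
Proof.
move=> e0; case: n => [|n].
  exists 1 => // y y0; rewrite expr0 mul1r.
  by rewrite -[leRHS]expR0 ler_expR oppr_le0 mulr_ge0// ltW.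
exists ((n.+1%:R / e) ^+ n.+1 * expR e).
  by rewrite mulr_gt0 ?expR_gt0// exprn_gt0// divr_gt0.
move=> y y0.
have h : 1 + y <= n.+1%:R / e * expR (e * (1 + y) / n.+1%:R).
  have := expR_ge1Dx (e * (1 + y) / n.+1%:R).
  have n0 : 0 < n.+1%:R :> R by [].
  rewrite -(ler_pM2l (divr_gt0 n0 e0)); apply: le_trans.
  rewrite mulrDr (_ : _ * (e * _ / _) = 1 + y); last by field; rewrite !gt_eqF.
  by rewrite lerDr mulr1 divr_ge0// ltW.
rewrite -ler_pdivlMr ?expR_gt0// -expRN opprK -mulrA -expRD.
apply: (le_trans (lerXn2r _ _ _ h)); rewrite ?nnegrE ?addr_ge0//.
  by rewrite mulr_ge0 ?expR_ge0// divr_ge0// ltW.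
rewrite exprMn -expRM_natl; apply: ler_wpM2l.
  by rewrite exprn_ge0// divr_ge0// ltW.
by rewrite mulrCA mulfV ?pnatr_eq0// mulr1 mulrDr mulr1.
Qed.

Lemma integral_gaussian (R : realType) (c : R) : 0 < c ->
  (\int[@lebesgue_measure R]_x (expR (- (c * x ^+ 2) / 2))%:E
   = (Num.sqrt (2 * pi / c))%:E)%E.
Proof.
move=> c0; have s0 : Num.sqrt c^-1 != 0 by rewrite gt_eqF// sqrtr_gt0 invr_gt0.
have := integral_normal_pdf 0 (Num.sqrt c^-1).
rewrite /normal_pdf (negbTE s0).
have pk0 := normal_peak_gt0 s0.
under eq_integral do rewrite EFinM.
rewrite ge0_integralZl//=; last 3 first.
- by apply/measurable_EFinP; exact: measurable_normal_fun.
- by move=> x _; rewrite lee_fin expR_ge0.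
- by rewrite lee_fin ltW.
rewrite /normal_peak sqr_sqrtr ?invr_ge0 ?ltW//.
rewrite (_ : Num.sqrt (c^-1 * pi *+ 2) = Num.sqrt (2 * pi / c)); last first.
  by congr Num.sqrt; rewrite -mulr_natl; ring.
have S0 : 0 < Num.sqrt (2 * pi / c).
  by rewrite sqrtr_gt0 divr_gt0// mulr_gt0// pi_gt0.
under eq_integral => x _.
  rewrite /normal_fun subr0 sqr_sqrtr ?invr_ge0 ?ltW//.
  rewrite (_ : - x ^+ 2 / (c^-1 *+ 2) = - (c * x ^+ 2) / 2); last first.
    by rewrite -mulr_natl; field; rewrite gt_eqF.
  over.
move=> /(congr1 (fun z => (Num.sqrt (2 * pi / c))%:E * z)%E).
by rewrite muleA -EFinM mulfV ?gt_eqF// mul1e mule1.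
Qed.

Lemma measurable_gaussian (R : realType) (c : R) (D : set (measurableTypeR R)) :
  measurable_fun D (fun x : measurableTypeR R => expR (- (c * x ^+ 2) / 2)).
Proof.
apply: measurable_funTS; apply: measurableT_comp => //.
apply: measurable_funM => //; apply: measurableT_comp => //.
by apply: measurable_funM => //; exact: measurable_funX.
Qed.

Lemma integrable_gaussian (R : realType) (c : R) : 0 < c ->
  (@lebesgue_measure R).-integrable setT
    (fun x => (expR (- (c * x ^+ 2) / 2))%:E).
Proof.
move=> c0; apply/integrableP; split.
  by apply/measurable_EFinP; exact: measurable_gaussian.
under eq_integral do rewrite gee0_abs ?lee_fin ?expR_ge0//.
by rewrite integral_gaussian// ltry.
Qed.

(** The integral over [-n, n] is F n - F (- n) and tends to the integral over
    the line by dominated convergence. *)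
Lemma Rintegral_derivative_eq0 (R : realType) (f F : R -> R) :
  continuous f -> (forall x : R, is_derive x 1 F (f x)) ->
  (@lebesgue_measure R).-integrable setT (EFin \o f) ->
  F n%:R @[n --> \oo] --> 0 -> F (- n%:R) @[n --> \oo] --> 0 ->
  \int[@lebesgue_measure R]_x f x = 0.
Proof.
move=> cf dF intf Fy FNy.
pose mu := @lebesgue_measure R.
(* Shifted by one so that the interval is never degenerate. *)
pose I n : set R := `[- n.+1%:R, n.+1%:R]%classic.
have FTC n : (\int[mu]_(x in I n) (f x)%:E = (F n.+1%:R - F (- n.+1%:R))%:E)%E.
  have dbF x : derivable F x 1 by have [] := dF x.
  have cF : continuous F.
    by move=> x; apply: differentiable_continuous; apply/derivable1_diffP.
  rewrite EFinB /I; apply: continuous_FTC2 => //.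
  - by rewrite (@lt_trans _ _ 0) ?oppr_lt0.
  - exact/continuous_subspaceT.
  - split=> [x _//||]; first exact/cvg_at_right_filter/cF.
    exact/cvg_at_left_filter/cF.
  - by move=> x _; rewrite derive1E; exact: derive_val.
have mf : measurable_fun (setT : set (measurableTypeR R)) f.
  exact: continuous_measurable_fun.
have cvg1 : (\int[mu]_x (((f \_ (I n)) x)%:E) @[n --> \oo] -->
             \int[mu]_x (f x)%:E)%E.
  apply: (@dominated_cvg _ _ _ mu _ measurableT
     (fun n x => ((f \_ (I n)) x)%:E) _ (fun x => `|f x|%:E)) => //=.
  - move=> n; apply/measurable_EFinP.
    apply/(measurable_restrictT f); first exact: measurable_itv.
    exact: (measurable_funTS mf).
  - move=> x _; apply: cvg_EFin; first exact: nearW.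
    apply: cvg_near_cst; exists (Num.bound `|x|) => // n /= hn.
    rewrite /= patchE mem_set// /I /= in_itv /= -ler_norml.
    rewrite (le_trans (ltW (archi_boundP (normr_ge0 _))))// ler_nat.
    by rewrite (leq_trans hn).
  - exact: integrable_norm.
  - move=> n x _; rewrite lee_fin patchE; case: ifPn => // _.
    by rewrite normr0.
have cvg2 : (\int[mu]_x (((f \_ (I n)) x)%:E) @[n --> \oo] --> 0%:E)%E.
  rewrite [X in X @ _ --> _](_ : _ =
      EFin \o (fun n => F n.+1%:R - F (- n.+1%:R))); last first.
    apply/funext => n /=; rewrite -FTC.
    by rewrite [RHS]integral_mkcond; under [RHS]eq_integral do rewrite restrict_EFin.
  apply: cvg_EFin; first exact: nearW.
  rewrite -(subr0 (0 : R)); apply: cvgB.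
    by rewrite (cvg_shiftS (fun n => F n%:R)).
  by rewrite (cvg_shiftS (fun n => F (- n%:R))).
by rewrite /Rintegral (cvg_unique _ cvg1 cvg2).
Qed.

(** * The Fourier transform of a Gaussian on the line *)

Lemma integrable_gaussian_dominated (R : realType) (c C : R) (h : R -> R) :
  0 < c -> continuous h -> (forall x, `|h x| <= C * expR (- (c * x ^+ 2) / 2)) ->
  (@lebesgue_measure R).-integrable setT (EFin \o h).
Proof.
move=> c0 ch hC.
apply: (le_integrable measurableT _ _ (integrableZl measurableT C (integrable_gaussian R c c0))).
  by apply/measurable_EFinP; exact: continuous_measurable_fun.
move=> x _; rewrite -EFinM !abse_EFin lee_fin (le_trans (hC x))//.
exact: ler_norm.
Qed.

Lemma is_derive_gaussian (R : realType) (c x : R) :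
  is_derive x (1 : R) (fun y : R => expR (- (c * y ^+ 2) / 2))
            (- (c * x) * expR (- (c * x ^+ 2) / 2)).
Proof.
have -> : (fun y : R => expR (- (c * y ^+ 2) / 2)) =
    expR \o ((- c / 2) \*: (@GRing.exp R ^~ 2%N)).
  by apply/funext => y /=; congr expR; rewrite /GRing.scale/=; ring.
apply: is_derive_eq; rewrite mulrC; congr (_ * expR _); last first.
  by rewrite -[LHS]/((- c / 2) * x ^+ 2); ring.
by rewrite -[LHS]/((- c / 2) * (x * 1 + x * 1)); field.
Qed.

Lemma is_derive_affine (R : realType) (a b x : R) :
  is_derive x (1 : R) (fun y : R => a * y + b) a.
Proof.
have -> : (fun y : R => a * y + b) = (a \*: id) + cst b.
  by apply/funext => y.
by apply: is_derive_eq; rewrite -[LHS]/(a * 1 + 0) mulr1 addr0.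
Qed.

Lemma is_derive_continuous (R : realType) (f df : R -> R) :
  (forall x : R, is_derive x (1 : R) f (df x)) -> continuous f.
Proof.
move=> h x; apply: differentiable_continuous; apply/derivable1_diffP.
by have [] := h x.
Qed.

(** One factor |x| costs half of the exponent. *)
Lemma gaussian_x_bound (R : realType) (c : R) : 0 < c ->
  exists2 C : R, 0 < C & forall x : R,
    `|x| * expR (- (c * x ^+ 2) / 2) <= C * expR (- (c / 2 * x ^+ 2) / 2).
Proof.
move=> c0; have c4 : 0 < c / 4 by rewrite divr_gt0.
have [C C0 hC] := expR_beats_power R 1 _ c4.
exists C => // x; rewrite (_ : - (c * x ^+ 2) / 2 =
  - (c / 4 * x ^+ 2) + - (c / 2 * x ^+ 2) / 2); last by field.
rewrite expRD mulrA ler_wpM2r ?expR_ge0//.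
apply: le_trans (hC _ (sqr_ge0 x)); rewrite expr1 ler_wpM2r ?expR_ge0//.
rewrite -[x ^+ 2]real_normK ?num_real//.
have := normr_ge0 x; nra.
Qed.

Lemma normr_cos_le1 (R : realType) (x : R) : `|cos x| <= 1.
Proof. by rewrite ler_norml cos_geN1 cos_le1. Qed.

Lemma normr_sin_le1 (R : realType) (x : R) : `|sin x| <= 1.
Proof. by rewrite ler_norml sin_geN1 sin_le1. Qed.

Lemma continuous_gaussian (R : realType) (c : R) :
  continuous (fun x : R => expR (- (c * x ^+ 2) / 2)).
Proof. by apply: is_derive_continuous => x; exact: is_derive_gaussian. Qed.

Lemma is_derive_cos_affine (R : realType) (a b x : R) :
  is_derive x (1 : R) (fun y : R => cos (a * y + b)) (- sin (a * x + b) * a).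
Proof.
rewrite -[X in is_derive _ _ X _]/(cos \o (fun y : R => a * y + b)).
apply: is_derive1_comp; exact: is_derive_affine.
Qed.

Lemma is_derive_sin_affine (R : realType) (a b x : R) :
  is_derive x (1 : R) (fun y : R => sin (a * y + b)) (cos (a * x + b) * a).
Proof.
rewrite -[X in is_derive _ _ X _]/(sin \o (fun y : R => a * y + b)).
apply: is_derive1_comp; exact: is_derive_affine.
Qed.

Lemma continuous_cos_affine (R : realType) (a b : R) :
  continuous (fun x : R => cos (a * x + b)).
Proof. by apply: is_derive_continuous => x; exact: is_derive_cos_affine. Qed.

Lemma continuous_sin_affine (R : realType) (a b : R) :
  continuous (fun x : R => sin (a * x + b)).
Proof. by apply: is_derive_continuous => x; exact: is_derive_sin_affine. Qed.

Lemma integrable_gaussian_cos (R : realType) (c a b : R) : 0 < c ->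
  (@lebesgue_measure R).-integrable setT
    (EFin \o (fun x => expR (- (c * x ^+ 2) / 2) * cos (a * x + b))).
Proof.
move=> c0; apply: (integrable_gaussian_dominated R c 1) => //.
- move=> x; apply: cvgM; first exact: continuous_gaussian.
  exact: continuous_cos_affine.
- move=> x; rewrite normrM ger0_norm ?expR_ge0// mulrC ler_wpM2r ?expR_ge0//.
  exact: normr_cos_le1.
Qed.

Lemma integrable_gaussian_x_sin (R : realType) (c a b : R) : 0 < c ->
  (@lebesgue_measure R).-integrable setT
    (EFin \o (fun x => x * (expR (- (c * x ^+ 2) / 2) * sin (a * x + b)))).
Proof.
move=> c0; have [C C0 hC] := gaussian_x_bound R c c0.
apply: (integrable_gaussian_dominated R (c / 2) C); first by rewrite divr_gt0.
- move=> x; apply: cvgM; first exact: cvg_id.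
  apply: cvgM; first exact: continuous_gaussian.
  exact: continuous_sin_affine.
- move=> x; apply: le_trans (hC x).
  rewrite normrM ler_wpM2l// normrM ger0_norm ?expR_ge0//.
  by rewrite ler_piMr ?expR_ge0 ?normr_sin_le1.
Qed.

Lemma cvg_gaussian_infty (R : realType) (c : R) (h : R -> R) (t : nat -> R) :
  0 < c -> (forall x, `|h x| <= 1) -> (forall n, `|t n| = n%:R) ->
  (expR (- (c * t n ^+ 2) / 2) * h (t n)) @[n --> \oo] --> (0 : R).
Proof.
move=> c0 h1 tn; apply/norm_cvg0P.
have [C C0 hC] := expR_beats_power R 1 _ (divr_gt0 c0 (@ltr0Sn R 1)).
apply: (@squeeze_cvgr _ _ _ _ (cst 0) (fun n => C * n.+1%:R^-1)).
- apply: nearW => n; rewrite normr_ge0 /= normrM ger0_norm ?expR_ge0//.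
  apply: (@le_trans _ _ (expR (- (c * t n ^+ 2) / 2))).
    by rewrite ler_piMr// expR_ge0.
  rewrite ler_pdivlMr// mulrC.
  apply: le_trans (hC _ (sqr_ge0 (t n))).
  rewrite (_ : - (c * t n ^+ 2) / 2 = - (c / 2 * t n ^+ 2)); last by field.
  rewrite ler_wpM2r ?expR_ge0// expr1 -natr1 addrC lerD2l.
  rewrite -[t n ^+ 2]real_normK ?num_real// tn -natrX ler_nat.
  by rewrite -mulnn; case: (n) => // m; exact: leq_pmulr.
- exact: cvg_cst.
- rewrite -[X in _ --> X](mulr0 C); apply: cvgMr.
  by apply: cvg_harmonic.
Qed.

(** As a function J of xi the integral satisfies J' = - (xi / c) J: differentiate
    under the integral sign, then integrate by parts.  So
    J(xi) exp (xi^2 / (2 c)) is constant, and its value at 0 is a Gaussian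
    integral.  The phase b turns the cosine and the sine transform into one
    statement. *)
Lemma Rintegral_gaussian_cos (R : realType) (c xi b : R) : 0 < c ->
  \int[@lebesgue_measure R]_x (expR (- (c * x ^+ 2) / 2) * cos (xi * x + b))
  = cos b * (Num.sqrt (2 * pi / c) * expR (- (c^-1 * xi ^+ 2) / 2)).
Proof.
move=> c0; set mu := @lebesgue_measure R.
pose J z := \int[mu]_x (expR (- (c * x ^+ 2) / 2) * cos (z * x + b)).
pose E z := expR (c^-1 * z ^+ 2 / 2).
have intcos z : mu.-integrable setT
    (EFin \o (fun x => expR (- (c * x ^+ 2) / 2) * cos (z * x + b))).
  exact: integrable_gaussian_cos.
have xsin z : \int[mu]_x (x * (expR (- (c * x ^+ 2) / 2) * sin (z * x + b))) =
    z / c * J z.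
  (* Integration by parts: F tends to 0 at infinity, so its derivative integrates to 0. *)
  pose F x := expR (- (c * x ^+ 2) / 2) * sin (z * x + b).
  pose f x := (- c) * (x * (expR (- (c * x ^+ 2) / 2) * sin (z * x + b)))
     + z * (expR (- (c * x ^+ 2) / 2) * cos (z * x + b)).
  have dF (x : R) : is_derive x 1 F (f x).
    apply: (@is_derive_eq _ _ _ _ _ _ _ _ (is_deriveM
      (is_derive_gaussian R c x) (is_derive_sin_affine R z b x))).
    rewrite /f -![_ *: _]/(_ * _); ring.
  have int1 := integrable_gaussian_x_sin R c z b c0.
  have int2 := integrable_gaussian_cos R c z b c0.
  have int1' := integrableZl measurableT (- c) int1.
  have int2' := integrableZl measurableT z int2.
  have : \int[mu]_x f x = 0.
    apply: (@Rintegral_derivative_eq0 _ f F) => //.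
    - move=> x; apply: cvgD; apply: cvgMr.
        apply: cvgM; first exact: cvg_id.
        apply: cvgM; first exact: continuous_gaussian.
        exact: continuous_sin_affine.
      apply: cvgM; first exact: continuous_gaussian.
      exact: continuous_cos_affine.
    - exact: (integrableD measurableT int1' int2').
    - apply: (cvg_gaussian_infty R c (fun x => sin (z * x + b)) (fun n => n%:R)) => //.
      + by move=> x; exact: normr_sin_le1.
      + by move=> n; rewrite ger0_norm.
    - apply: (cvg_gaussian_infty R c (fun x => sin (z * x + b)) (fun n => - n%:R)) => //.
      + by move=> x; exact: normr_sin_le1.
      + by move=> n; rewrite normrN ger0_norm.
  rewrite /f RintegralD// !RintegralZl//.
  rewrite -/(J z) => h; apply: (@mulfI _ c); first by rewrite gt_eqF.
  move: h; set X := Rintegral _ _ _ => h.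
  rewrite mulrA mulrCA mulfV ?gt_eqF// mulr1; lra.
have dJ (z : R) : is_derive z 1 J (- (z / c * J z)).
  have [C C0 hC] := gaussian_x_bound R c c0.
  pose f z x := expR (- (c * x ^+ 2) / 2) * cos (z * x + b).
  have df (y x : R) : is_derive y (1:R) (f ^~ x)
      (- (x * (expR (- (c * x ^+ 2) / 2) * sin (y * x + b)))).
    rewrite /f; under eq_fun do rewrite (mulrC _ x).
    apply: (@is_derive_eq _ _ _ _ _ _ _ _
      (is_deriveZ (expR (- (c * x ^+ 2) / 2)) (is_derive_cos_affine R x b y))).
    rewrite -![_ *: _]/(_ * _) (mulrC y); ring.
  have dfE y x : partial1of2 f y x =
      - (x * (expR (- (c * x ^+ 2) / 2) * sin (y * x + b))).
    by rewrite partial1of2E; exact: derive_val.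
  have Iz : `]z - 1, z + 1[%classic z.
    by rewrite /= in_itv/= ltrBlDr !ltrDl ltr01.
  have G0 x : 0 <= C * expR (- (c / 2 * x ^+ 2) / 2).
    by rewrite mulr_ge0 ?expR_ge0 ?ltW.
  have intG : mu.-integrable setT
      (EFin \o (fun x => C * expR (- (c / 2 * x ^+ 2) / 2))).
    apply: (integrableZl measurableT C (integrable_gaussian R (c / 2) _)).
    by rewrite divr_gt0.
  have Gub y x : `]z - 1, z + 1[%classic y -> setT x ->
      `|partial1of2 f y x| <= C * expR (- (c / 2 * x ^+ 2) / 2).
    move=> _ _; rewrite dfE normrN; apply: le_trans (hC x).
    rewrite normrM ler_wpM2l// normrM ger0_norm ?expR_ge0//.
    by rewrite ler_piMr ?expR_ge0 ?normr_sin_le1.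
  have df1 y x : `]z - 1, z + 1[%classic y -> setT x -> derivable (f^~ x) y 1.
    by move=> _ _; have [] := df y x.
  have intf y : `]z - 1, z + 1[%classic y -> mu.-integrable setT (EFin \o f y).
    by move=> _; exact: intcos.
  apply: DeriveDef.
    exact: (derivable_under_integral measurableT Iz intf df1 G0 intG Gub).
  rewrite -derive1E.
  rewrite (differentiation_under_integral measurableT Iz intf df1 G0 intG Gub).
  under eq_Rintegral do rewrite dfE -mulN1r.
  rewrite RintegralZl// ?xsin ?mulN1r//.
  exact: integrable_gaussian_x_sin.
have dE (z : R) : is_derive z 1 E (z / c * E z).
  rewrite /E; have := is_derive_gaussian R (- c^-1) z.
  rewrite (_ : (fun y => _) = (fun z => expR (c^-1 * z ^+ 2 / 2))); last first.
    by apply/funext => y; congr expR; ring.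
  move=> h; apply: (is_derive_eq h); congr (_ * expR _); ring.
have JE0 (z : R) : is_derive z 1 (J * E) 0.
  apply: (@is_derive_eq _ _ _ _ _ _ _ _ (is_deriveM (dJ z) (dE z))).
  rewrite -![_ *: _]/(_ * _); ring.
have := is_derive_0_is_cst xi 0 JE0.
rewrite -![(J * E) _]/(J _ * E _) {2}/E expr0n /= mulr0 mul0r expR0 mulr1.
have -> : J 0 = cos b * Num.sqrt (2 * pi / c).
  rewrite /J; under eq_Rintegral do rewrite mul0r add0r mulrC.
  rewrite RintegralZl//; last exact: integrable_gaussian.
  by rewrite /Rintegral integral_gaussian.
move=> h; rewrite -[LHS]/(J xi) mulrA -h -mulrA /E -expRD.
by rewrite mulNr subrr expR0 mulr1.
Qed.

(** * Gaussian integrals in several variables *)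

(** The measure on tuples is built by adding one coordinate in front, so
    Tonelli and Fubini peel off the first coordinate. *)
Lemma ge0_integral_lebesgue_tupleS (R : realType) (N : nat)
    (f : N.+1.-tuple (measurableTypeR R) -> \bar R) :
  measurable_fun setT f -> (forall t, 0 <= f t)%E ->
  (\int[lebesgue_tuple R N.+1]_t f t =
   \int[@lebesgue_measure R]_a \int[lebesgue_tuple R N]_t f (cons_pair (a, t)))%E.
Proof.
move=> mf f0; have mc := @measurable_cons_pair R N.
transitivity (\int[@lebesgue_measure R \x lebesgue_tuple R N]_z f (cons_pair z))%E.
  by rewrite [LHS](ge0_integral_pushforward mc) ?preimage_setT//.
by rewrite fubini_tonelli1//; exact: measurableT_comp.
Qed.

Lemma integral_lebesgue_tupleS (R : realType) (N : nat)
    (f : N.+1.-tuple (measurableTypeR R) -> \bar R) :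
  (lebesgue_tuple R N.+1).-integrable setT f ->
  (\int[lebesgue_tuple R N.+1]_t f t =
   \int[@lebesgue_measure R]_a \int[lebesgue_tuple R N]_t f (cons_pair (a, t)))%E.
Proof.
move=> intf; have mc := @measurable_cons_pair R N.
have mf := measurable_int _ intf.
have intfc : (@lebesgue_measure R \x lebesgue_tuple R N)%E.-integrable setT
    (f \o cons_pair (N := N)).
  apply/integrableP; split; first exact: measurableT_comp.
  move/integrableP : intf => [_]; apply: le_lt_trans.
  rewrite [leRHS](ge0_integral_pushforward mc) ?preimage_setT//.
  exact: measurableT_comp.
transitivity (\int[@lebesgue_measure R \x lebesgue_tuple R N]_z f (cons_pair z))%E.
  by rewrite [LHS](integral_pushforward mc) ?preimage_setT.
by rewrite -integral12_prod_meas1.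
Qed.

(** The quadratic form is always diagonal; c lists its coefficients. *)
Definition gaussian {R : realType} {N : nat} (c : 'I_N -> R) (t : N.-tuple R) : R :=
  expR (- (\sum_(i < N) c i * tnth t i ^+ 2) / 2).

Definition pairing {R : realType} {N : nat} (x : 'I_N -> R) (t : N.-tuple R) : R :=
  \sum_(i < N) x i * tnth t i.

Lemma measurable_quadratic (R : realType) (N : nat) (P : pred 'I_N) (c : 'I_N -> R) :
  measurable_fun setT
    (fun t : N.-tuple (measurableTypeR R) => \sum_(i < N | P i) c i * tnth t i ^+ 2).
Proof.
under eq_fun do rewrite big_mkcond.
apply: measurable_sum => i; case: (P i) => //; apply: measurable_funM => //.
by apply: measurable_funX; exact: measurable_tnth.
Qed.

Lemma measurable_block_square (R : realType) (N : nat) (P : pred 'I_N) :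
  measurable_fun setT
    (fun t : N.-tuple (measurableTypeR R) => \sum_(i < N | P i) tnth t i ^+ 2).
Proof.
have := @measurable_quadratic R N P (fun=> 1).
by apply: eq_measurable_fun => t _; apply: eq_bigr => i _; rewrite mul1r.
Qed.

Lemma measurable_ngaussian (R : realType) (N : nat) (c : 'I_N -> R) :
  measurable_fun setT (gaussian c : N.-tuple (measurableTypeR R) -> R).
Proof.
apply: measurableT_comp => //; apply: measurable_funM => //.
by apply: measurableT_comp => //; exact: measurable_quadratic.
Qed.

Lemma measurable_pairing (R : realType) (N : nat) (c : 'I_N -> R) :
  measurable_fun setT (pairing c : N.-tuple (measurableTypeR R) -> R).
Proof.
apply: measurable_sum => i; apply: measurable_funM => //.
exact: measurable_tnth.
Qed.

Lemma gaussian_ge0 (R : realType) (N : nat) (c : 'I_N -> R) t : 0 <= gaussian c t.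
Proof. exact: expR_ge0. Qed.

Lemma gaussian_cons (R : realType) (N : nat) (c : 'I_N.+1 -> R) a (t : N.-tuple R) :
  gaussian c (cons_pair (a, t)) =
  expR (- (c ord0 * a ^+ 2) / 2) * gaussian (fun i => c (lift ord0 i)) t.
Proof.
rewrite /gaussian big_ord_recl -expRD; congr expR.
rewrite tnth0 opprD mulrDl; congr (_ + - _ / _).
by apply: eq_bigr => i _; rewrite tnthS.
Qed.

Lemma pairing_cons (R : realType) (N : nat) (c : 'I_N.+1 -> R) a (t : N.-tuple R) :
  pairing c (cons_pair (a, t)) = c ord0 * a + pairing (fun i => c (lift ord0 i)) t.
Proof.
rewrite /pairing big_ord_recl tnth0; congr (_ + _).
by apply: eq_bigr => i _; rewrite tnthS.
Qed.

Lemma integral_ngaussian (R : realType) (N : nat) (c : 'I_N -> R) :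
  (forall i, 0 < c i) ->
  (\int[lebesgue_tuple R N]_t (gaussian c t)%:E =
   (\prod_(i < N) Num.sqrt (2 * pi / c i))%:E)%E.
Proof.
elim: N c => [|N IH] c c0.
  rewrite [LHS]integral_dirac//= ?diracT ?mul1e; last first.
    by apply/measurable_EFinP; exact: measurable_ngaussian.
  by rewrite /gaussian !big_ord0 oppr0 mul0r expR0.
rewrite ge0_integral_lebesgue_tupleS; last 2 first.
- by apply/measurable_EFinP; exact: measurable_ngaussian.
- by move=> t; rewrite lee_fin gaussian_ge0.
under eq_integral => a _.
  under eq_integral do rewrite gaussian_cons EFinM.
  rewrite ge0_integralZl//=; last 2 first.
  - by apply/measurable_EFinP; exact: measurable_ngaussian.
  - by move=> t _; rewrite lee_fin gaussian_ge0.
  rewrite IH//; over.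
rewrite ge0_integralZr//=; last 2 first.
- by apply/measurable_EFinP; exact: measurable_gaussian.
- by rewrite lee_fin prodr_ge0// => i _; rewrite sqrtr_ge0.
by rewrite integral_gaussian// big_ord_recl EFinM.
Qed.

Lemma integrable_ngaussian (R : realType) (N : nat) (c : 'I_N -> R) :
  (forall i, 0 < c i) ->
  (lebesgue_tuple R N).-integrable setT (EFin \o gaussian c).
Proof.
move=> c0; apply/integrableP; split.
  by apply/measurable_EFinP; exact: measurable_ngaussian.
under eq_integral do rewrite gee0_abs ?lee_fin ?gaussian_ge0//.
by rewrite integral_ngaussian// ltry.
Qed.

Lemma integrable_ngaussian_dominated (R : realType) (N : nat) (C : R)
    (c : 'I_N -> R) (h : N.-tuple (measurableTypeR R) -> R) :
  (forall i, 0 < c i) -> measurable_fun setT h ->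
  (forall t, `|h t| <= C * gaussian c t) ->
  (lebesgue_tuple R N).-integrable setT (EFin \o h).
Proof.
move=> c0 mh hC.
apply: (le_integrable measurableT _ _
  (integrableZl measurableT C (integrable_ngaussian _ _ c c0))).
  exact/measurable_EFinP.
move=> x _; rewrite -EFinM !abse_EFin lee_fin (le_trans (hC x))//.
exact: ler_norm.
Qed.

Lemma measurable_cos_pairing (R : realType) (N : nat) (x : 'I_N -> R) (b : R) :
  measurable_fun setT
    (fun t : N.-tuple (measurableTypeR R) => cos (pairing x t + b)).
Proof.
apply: (@measurableT_comp _ _ _ _ _ _ (@cos R)).
  by apply: continuous_measurable_fun; exact: continuous_cos.
by apply: measurable_funD => //; exact: measurable_pairing.
Qed.

Lemma integrable_ngaussian_cos (R : realType) (N : nat) (c x : 'I_N -> R) (b : R) :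
  (forall i, 0 < c i) ->
  (lebesgue_tuple R N).-integrable setT
    (EFin \o (fun t => gaussian c t * cos (pairing x t + b))).
Proof.
move=> c0; apply: (integrable_ngaussian_dominated R N 1 c) => //.
  apply: measurable_funM; [exact: measurable_ngaussian|exact: measurable_cos_pairing].
move=> t; rewrite normrM ger0_norm ?gaussian_ge0// mulrC.
by rewrite ler_wpM2r ?gaussian_ge0 ?normr_cos_le1.
Qed.

(** Integrate the last coordinates first: the first coordinate enters only as
    the extra phase [x ord0 * a], so the induction hypothesis applies as it is
    and a one-dimensional integral remains. *)
Lemma integral_ngaussian_cos (R : realType) (N : nat) (c x : 'I_N -> R) (b : R) :
  (forall i, 0 < c i) ->
  (\int[lebesgue_tuple R N]_t (gaussian c t * cos (pairing x t + b))%:E =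
   (cos b * \prod_(i < N)
      (Num.sqrt (2 * pi / c i) * expR (- ((c i)^-1 * x i ^+ 2) / 2)))%:E)%E.
Proof.
elim: N c x b => [|N IH] c x b c0.
  rewrite [LHS]integral_dirac//= ?diracT ?mul1e; last first.
    apply/measurable_EFinP.
    apply: measurable_funM; [exact: measurable_ngaussian|exact: measurable_cos_pairing].
  by rewrite /gaussian /pairing !big_ord0 oppr0 mul0r expR0 mul1r add0r mulr1.
rewrite integral_lebesgue_tupleS; last exact: integrable_ngaussian_cos.
pose c' i := c (lift ord0 i); pose x' i := x (lift ord0 i).
set K := \prod_(i < N) (Num.sqrt (2 * pi / c' i) * expR (- ((c' i)^-1 * x' i ^+ 2) / 2)).
under eq_integral => a _.
  under eq_integral => t _.
    rewrite gaussian_cons pairing_cons -mulrA EFinM.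
    rewrite (addrC (x ord0 * a)) -addrA; over.
  rewrite integralZl//=; last exact: integrable_ngaussian_cos.
  rewrite IH// -EFinM mulrA; over.
under eq_integral do rewrite EFinM.
have i1 := integrable_gaussian_cos R (c ord0) (x ord0) b (c0 ord0).
rewrite integralZr//=.
have fi := integrable_fin_num measurableT i1.
have -> : (\int[@lebesgue_measure R]_a
    (expR (- (c ord0 * a ^+ 2) / 2) * cos (x ord0 * a + b))%:E)%E
    = (cos b * (Num.sqrt (2 * pi / c ord0) *
        expR (- ((c ord0)^-1 * x ord0 ^+ 2) / 2)))%:E.
  by rewrite -Rintegral_gaussian_cos// /Rintegral fineK.
by rewrite -EFinM big_ord_recl -!mulrA.
Qed.

(** * Even powers of a block norm against a Gaussian *)

Section heat_poly.
Context {R : realType}.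

(** [heat_poly k m] is the polynomial factor of the m-th derivative of
    v^(-k) exp (- z / (2 v)), with alternating sign; the recursion is the product
    rule, written in the variable z / v. *)
Fixpoint heat_poly (k : R) (m : nat) : {poly R} :=
  if m is m'.+1 then
    let Q := heat_poly k m' in
    (k + m'%:R) *: Q + 'X * Q^`() - 2^-1 *: ('X * Q)
  else 1.

Definition heat (k z : R) (m : nat) (v : R) : R :=
  v `^ (- k - m%:R) * ((heat_poly k m).[z / v] * expR (- (z / v) / 2)).

Lemma is_derive_heat (k z : R) (m : nat) (v : R) : 0 < v ->
  is_derive v (1 : R) (heat k z m) (- heat k z m.+1 v).
Proof.
move=> v0; have vn0 : v != 0 by rewrite gt_eqF.
have dq : is_derive v (1 : R) (fun y : R => z * y^-1) (- (z / v) / v).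
  have -> : (fun y : R => z * y^-1) = z \*: (@GRing.inv R) by [].
  apply: (is_derive_eq (is_deriveZ z (is_deriveV vn0 (is_derive_id v (1 : R))))).
  by rewrite -![_ *: _]/(_ * _); field.
have dp : is_derive v (1 : R) (fun y : R => (heat_poly k m).[z / y])
    ((heat_poly k m)^`().[z / v] * (- (z / v) / v)).
  rewrite -[X in is_derive _ _ X _]/((fun w => (heat_poly k m).[w]) \o
    (fun y : R => z * y^-1)).
  apply: is_derive1_comp; exact: is_derive_poly.
have de : is_derive v (1 : R) (fun y : R => expR (- (z / y) / 2))
    (expR (- (z / v) / 2) * (- (- (z / v) / v) / 2)).
  rewrite (_ : (fun y : R => _) = expR \o ((- 2^-1) \*: (fun y : R => z * y^-1))).
    apply: (is_derive_eq (is_derive1_comp (is_derive_expR _) (is_deriveZ (- 2^-1) dq))).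
    rewrite -![_ *: _]/(_ * _) -[(_ \*: _) v]/(_ * _).
    by rewrite (_ : - 2^-1 * (z * v^-1) = - (z / v) / 2); [congr (_ * _); ring|ring].
  by apply/funext => y /=; congr expR; rewrite -[RHS]/(_ * _); ring.
have dw := is_derive1_powR (- k - m%:R) v0.
apply: (is_derive_eq (is_deriveM dw (is_deriveM dp de))).
rewrite /heat -![_ *: _]/(_ * _) /=.
rewrite !(hornerD, hornerN, hornerZ, hornerM, hornerX).
set q := (heat_poly k m).[_]; set q' := (heat_poly k m)^`().[_].
set e := expR _.
rewrite (_ : - k - m.+1%:R = - k - m%:R - 1); last by rewrite -natr1; ring.
rewrite (_ : v `^ (- k - m%:R) = v * v `^ (- k - m%:R - 1)); last first.
  by rewrite -{2}(powRr1 (ltW v0)) -powRD ?vn0 ?implybT//; congr powR; ring.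
rewrite -[X in _ + X * _ = _]/(q * e).
by field.
Qed.

(** Horner form: multiplication by the variable raises n by one. *)
Lemma poly_growth (Q : {poly R}) :
  exists n, exists2 C : R, 0 < C & forall w : R, 0 <= w -> `|Q.[w]| <= C * (1 + w) ^+ n.
Proof.
elim/poly_ind: Q => [|Q c [n [C C0 IH]]].
  by exists 0%N, 1 => // w _; rewrite horner0 normr0 expr0 mulr1.
exists n.+1, (C + `|c|); first by rewrite ltr_pwDl.
move=> w w0; rewrite hornerMXaddC (le_trans (ler_normD _ _))// mulrDl.
have w1 : 1 <= 1 + w by rewrite lerDl.
apply: lerD; last by rewrite ler_peMr// exprn_ege1.
rewrite normrM (ger0_norm w0) exprSr mulrA ler_pM ?IH//.
by rewrite lerDr.
Qed.

(** Half of the exponent absorbs the polynomial. *)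
Lemma heat_poly_bound (k : R) (m : nat) :
  exists2 C : R, 0 < C & forall w : R, 0 <= w ->
    `|(heat_poly k m).[w]| * expR (- w / 2) <= C * expR (- w / 4).
Proof.
have [n [C C0 hC]] := poly_growth (heat_poly k m).
have [D D0 hD] := @expR_beats_power R n 4^-1 ltac:(by rewrite invr_gt0).
exists (C * D); first by rewrite mulr_gt0.
move=> w w0; rewrite (_ : - w / 2 = - (4^-1 * w) + - w / 4); last by field.
rewrite expRD mulrA ler_wpM2r ?expR_ge0//.
apply: (@le_trans _ _ (C * (1 + w) ^+ n * expR (- (4^-1 * w)))).
  by rewrite ler_wpM2r ?expR_ge0// hC.
by rewrite -mulrA ler_wpM2l ?hD// ltW.
Qed.

End heat_poly.

Section block.
Context {R : realType} {N : nat}.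
Variables (P : pred 'I_N) (b : R) (a : 'I_N -> R).
Hypotheses (b0 : 0 < b) (a0 : forall i, 0 < a i) (aP : forall i, P i -> a i = b).

(** At v = 1 these are the coefficients of the Fourier transform of the Gaussian
    with coefficients a; v varies the width in the directions of the block P only. *)
Definition block_coef (v : R) (i : 'I_N) : R := if P i then v / b else (a i)^-1.

(** The quantity y = |t_P|^2 / (2 b) conjugate to v: increasing v by w multiplies
    the Gaussian by exp (- w y). *)
Definition block_energy (t : N.-tuple R) : R :=
  (\sum_(i < N | P i) tnth t i ^+ 2) / (2 * b).

Lemma block_energy_ge0 t : 0 <= block_energy t.
Proof. by rewrite divr_ge0 ?sumr_ge0// => *; rewrite ?sqr_ge0// mulr_ge0// ltW. Qed.

Lemma measurable_block_energy :
  measurable_fun setT (block_energy : N.-tuple (measurableTypeR R) -> R).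
Proof.
apply: measurable_funM => //.
exact: measurable_block_square.
Qed.

Lemma block_coef_gt0 v i : 0 < v -> 0 < block_coef v i.
Proof. by rewrite /block_coef; case: ifP => _ v0; rewrite ?divr_gt0// invr_gt0. Qed.

Lemma gaussian_block_coefD v w t :
  gaussian (block_coef (v + w)) t =
  expR (- (w * block_energy t)) * gaussian (block_coef v) t.
Proof.
rewrite /gaussian -expRD; congr expR.
have -> : \sum_(i < N) block_coef (v + w) i * tnth t i ^+ 2 =
  \sum_(i < N) block_coef v i * tnth t i ^+ 2 + 2 * (w * block_energy t).
  rewrite /block_energy mulr_suml !mulr_sumr [in X in _ = _ + X]big_mkcond.
  rewrite -big_split; apply: eq_bigr => i _; rewrite /block_coef.
  by case: ifP => _ /=; field; rewrite gt_eqF.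
by field.
Qed.

(** Powers of the energy are absorbed by a wider Gaussian in the block.  This
    dominates the integrands below and their derivatives in v. *)
Lemma energy_gaussian_bound (m : nat) (w : R) : 0 < w ->
  exists2 C : R, 0 < C & forall v t,
    block_energy t ^+ m * gaussian (block_coef (v + w)) t <=
    C * gaussian (block_coef v) t.
Proof.
move=> w0; have [C C0 hC] := @expR_beats_power R m w w0.
exists C => // v t; rewrite gaussian_block_coefD mulrA.
rewrite ler_wpM2r ?gaussian_ge0//; apply: le_trans (hC _ (block_energy_ge0 t)).
rewrite ler_wpM2r ?expR_ge0// lerXn2r ?nnegrE ?addr_ge0 ?block_energy_ge0//.
by rewrite lerDr.
Qed.

Variables (x : 'I_N -> R) (u : R).

(** The integrand of the inverse Fourier transform of y^m exp (- v y), times a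
    fixed Gaussian in the other variables, evaluated at x. *)
Definition block_osc (m : nat) (v : R) (t : N.-tuple R) : R :=
  block_energy t ^+ m * (gaussian (block_coef v) t * cos (pairing x t + u)).

Lemma measurable_block_osc m v :
  measurable_fun setT (block_osc m v : N.-tuple (measurableTypeR R) -> R).
Proof.
apply: measurable_funM.
  by apply: measurable_funX; exact: measurable_block_energy.
by apply: measurable_funM; [exact: measurable_ngaussian|exact: measurable_cos_pairing].
Qed.

Lemma block_osc_le m v t :
  `|block_osc m v t| <= block_energy t ^+ m * gaussian (block_coef v) t.
Proof.
rewrite /block_osc normrM ger0_norm ?exprn_ge0 ?block_energy_ge0//.
rewrite ler_wpM2l ?exprn_ge0 ?block_energy_ge0//.
by rewrite normrM ger0_norm ?gaussian_ge0// ler_piMr ?gaussian_ge0 ?normr_cos_le1.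
Qed.

Lemma integrable_block_osc m v : 0 < v ->
  (lebesgue_tuple R N).-integrable setT (EFin \o block_osc m v).
Proof.
move=> v0; have v20 : 0 < v / 2 by rewrite divr_gt0.
have [C C0 hC] := energy_gaussian_bound m (v / 2) v20.
apply: (integrable_ngaussian_dominated R N C (block_coef (v / 2))).
- by move=> i; exact: block_coef_gt0.
- exact: measurable_block_osc.
- move=> t; apply: le_trans (block_osc_le m v t) _.
  by rewrite {1}[v]splitr.
Qed.

Definition block_integral (m : nat) (v : R) : R :=
  \int[lebesgue_tuple R N]_t block_osc m v t.

(** Each derivative in v brings down one factor - y. *)
Lemma is_derive_block_integral m (v : R) : 0 < v ->
  is_derive v (1 : R) (block_integral m) (- block_integral m.+1 v).
Proof.
move=> v0; have v40 : 0 < v / 4 by rewrite divr_gt0.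
have [C C0 hC] := energy_gaussian_bound m.+1 (v / 4) v40.
have df (w : R) t : is_derive w (1 : R) (block_osc m ^~ t) (- block_osc m.+1 w t).
  have -> : block_osc m ^~ t = (block_energy t ^+ m *
      (gaussian (block_coef 0) t * cos (pairing x t + u))) \*:
      (expR \o ((- block_energy t) \*: id)).
    apply/funext => w'; rewrite /block_osc -{1}[w']add0r gaussian_block_coefD.
    rewrite -[RHS]/(_ * _) /= -[(- _) *: _]/(_ * _) (mulrC (- _)) mulrN; ring.
  apply: is_derive_eq; rewrite -![_ *: _]/(_ * _) -![(_ \*: _) _]/(_ * _) /=.
  rewrite /block_osc -{2}[w]add0r gaussian_block_coefD exprS.
  by rewrite (mulrC (- _) w) mulrN; ring.
have dfE w t : partial1of2 (block_osc m) w t = - block_osc m.+1 w t.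
  by rewrite partial1of2E; exact: derive_val.
(* On this interval the derivative is dominated by the Gaussian of parameter v / 4. *)
pose I : set R := `]v / 2, v + 1[%classic.
have Iv : I v by rewrite /I /= in_itv/= ltrDl ltr01 andbT gtr_pMr// invf_lt1// ltr1n.
have I0 w : I w -> v / 2 < w by rewrite /I /= in_itv/= => /andP[].
pose G t := C * gaussian (block_coef (v / 4)) t.
have G0 t : 0 <= G t by rewrite mulr_ge0 ?gaussian_ge0// ltW.
have intG : (lebesgue_tuple R N).-integrable setT (EFin \o G).
  apply: (integrableZl measurableT C (integrable_ngaussian _ _ (block_coef (v / 4)) _)).
  by move=> i; exact: block_coef_gt0.
have Gub w t : I w -> setT t -> `|partial1of2 (block_osc m) w t| <= G t.
  move=> Iw _; rewrite dfE normrN; apply: le_trans (block_osc_le _ _ _) _.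
  apply: le_trans (hC (v / 4) t).
  rewrite ler_wpM2l ?exprn_ge0 ?block_energy_ge0//.
  rewrite (_ : v / 4 + v / 4 = v / 2); last by field.
  rewrite -(subrK (v / 2) w) addrC gaussian_block_coefD ler_piMl ?gaussian_ge0//.
  rewrite -[leRHS]expR0 ler_expR oppr_le0 mulr_ge0 ?block_energy_ge0//.
  by rewrite subr_ge0 ltW// I0.
have intf w : I w -> (lebesgue_tuple R N).-integrable setT (EFin \o block_osc m w).
  move=> /I0 vw; apply: integrable_block_osc; apply: lt_trans vw.
  by rewrite divr_gt0.
have df1 w t : I w -> setT t -> derivable (block_osc m ^~ t) w 1.
  by move=> _ _; have [] := df w t.
apply: DeriveDef.
  exact: (derivable_under_integral measurableT Iv intf df1 G0 intG Gub).
rewrite -derive1E.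
rewrite (differentiation_under_integral measurableT Iv intf df1 G0 intG Gub).
under eq_Rintegral do rewrite dfE -mulN1r.
by rewrite RintegralZl ?mulN1r//; exact: integrable_block_osc.
Qed.

End block.

Section block_bound.
Context {R : realType} {N : nat}.
Variables (P : pred 'I_N) (b : R) (a : 'I_N -> R).
Hypotheses (b0 : 0 < b) (a0 : forall i, 0 < a i) (aP : forall i, P i -> a i = b).
Variables (x : 'I_N -> R) (u : R).

Definition off_block_gaussian : R :=
  expR (- (\sum_(i < N | ~~ P i) a i * x i ^+ 2) / 2).

(** The quantity z = b |x_P|^2 on the side of x, dual to [block_energy]. *)
Definition on_block_energy : R := b * \sum_(i < N | P i) x i ^+ 2.

Definition gaussian_mass : R := \prod_(i < N) Num.sqrt (2 * pi * a i).

(** For m = 0 this is a pure Gaussian transform; the factors are sorted into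
    the total mass, the Gaussian in the variables off the block, and the block
    itself. *)
Lemma block_integral0 (v : R) : 0 < v ->
  block_integral P b a x u 0 v =
  cos u * gaussian_mass * off_block_gaussian *
    heat (#|P|%:R / 2) on_block_energy 0 v.
Proof.
move=> v0; rewrite /block_integral /block_osc.
under eq_Rintegral do rewrite expr0 mul1r.
rewrite /Rintegral integral_ngaussian_cos/=; last first.
  by move=> i; exact: block_coef_gt0.
rewrite -!mulrA; congr (_ * _).
transitivity (\prod_(i < N) (Num.sqrt (2 * pi * a i) *
  ((if ~~ P i then expR (- (a i * x i ^+ 2) / 2) else 1) *
  ((if P i then v `^ (- 2^-1) else 1) *
   (if P i then expR (- (b * x i ^+ 2 / v) / 2) else 1))))).
  apply: eq_bigr => i _; rewrite /block_coef; case: ifPn => /= Pi.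
    rewrite (aP _ Pi) mul1r [RHS]mulrA; congr (_ * expR _); last first.
      by field; rewrite !gt_eqF.
    rewrite powRN powR12_sqrt ?ltW// -sqrtrV ?ltW// -sqrtrM; last first.
      by rewrite !mulr_ge0 ?pi_ge0 ?ltW.
    by congr Num.sqrt; field; rewrite !gt_eqF.
  by rewrite !mulr1 !invrK.
rewrite !big_split; congr (_ * (_ * _)).
  rewrite -big_mkcond /off_block_gaussian -expR_sum; congr expR.
  by rewrite -mulr_suml sumrN.
rewrite /heat /= hornerC mul1r subr0 -!big_mkcond; congr (_ * _).
  rewrite prodr_const -powR_mulrn ?powR_ge0// -powRrM; congr powR.
  by rewrite mulNr mulrC.
rewrite -expR_sum; congr expR.
by rewrite /on_block_energy mulr_sumr mulr_suml -sumrN mulr_suml.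
Qed.

(** Both sides satisfy the same recursion f_{m+1} = - f_m' in v, and they agree
    for m = 0. *)
Lemma block_integralE m (v : R) : 0 < v ->
  block_integral P b a x u m v =
  cos u * gaussian_mass * off_block_gaussian *
    heat (#|P|%:R / 2) on_block_energy m v.
Proof.
set K := cos u * gaussian_mass * off_block_gaussian.
elim: m v => [|m IH] v v0; first exact: block_integral0.
have d1 := is_derive_block_integral P b a b0 a0 x u m v v0.
have d2 := is_deriveZ K (is_derive_heat (#|P|%:R / 2) on_block_energy m v v0).
have nr : \forall w \near v, block_integral P b a x u m w =
    (K \*: heat (#|P|%:R / 2) on_block_energy m) w.
  near=> w; apply: IH; near: w; exact: (cvgr_gt v).
have d3 := near_eq_is_derive nr d1.
have := @derive_val _ _ _ _ _ _ _ d3.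
rewrite (@derive_val _ _ _ _ _ _ _ d2) -[_ *: _]/(_ * _) mulrN.
by move/oppr_inj.
Unshelve. all: by end_near. Qed.

End block_bound.

Lemma block_integral_bound (R : realType) (N : nat) (P : pred 'I_N) (m : nat) :
  exists2 C : R, 0 < C & forall (b : R) (a x : 'I_N -> R) (u v : R),
    0 < b -> (forall i, 0 < a i) -> (forall i, P i -> a i = b) -> 0 < v ->
    `|block_integral P b a x u m v| <=
    C * \prod_(i < N) Num.sqrt (a i) * off_block_gaussian P a x *
      (v `^ (- (#|P|%:R / 2) - m%:R) * expR (- (on_block_energy P b x / v) / 4)).
Proof.
have [C C0 hC] := heat_poly_bound (#|P|%:R / 2 : R) m.
exists (Num.sqrt (2 * pi) ^+ N * C).
  by rewrite mulr_gt0// exprn_gt0// sqrtr_gt0 mulr_gt0 ?pi_gt0.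
move=> b a x u v b0 a0 aP v0; rewrite block_integralE//.
have zv : 0 <= on_block_energy P b x / v.
  rewrite divr_ge0 ?(ltW v0)// mulr_ge0 ?(ltW b0)// sumr_ge0// => i _.
  exact: sqr_ge0.
have mE : gaussian_mass a = Num.sqrt (2 * pi) ^+ N * \prod_(i < N) Num.sqrt (a i).
  rewrite -[in _ ^+ N](card_ord N) -prodr_const -big_split.
  by apply: eq_bigr => i _; rewrite sqrtrM// mulr_ge0// pi_ge0.
have m0 : 0 <= gaussian_mass a by rewrite prodr_ge0// => i _; rewrite sqrtr_ge0.
have o0 : 0 <= off_block_gaussian P a x by exact: expR_ge0.
rewrite 3!normrM (ger0_norm m0) (ger0_norm o0) /heat normrM.
rewrite (ger0_norm (powR_ge0 _ _)) normrM (ger0_norm (expR_ge0 _)).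
apply: (@le_trans _ _ (1 * gaussian_mass a * off_block_gaussian P a x *
  (v `^ (- (#|P|%:R / 2) - m%:R) * (C * expR (- (on_block_energy P b x / v) / 4))))).
  apply: ler_pM.
  - by rewrite !mulr_ge0.
  - by rewrite !mulr_ge0 ?powR_ge0 ?expR_ge0.
  - by rewrite !ler_wpM2r// normr_cos_le1.
  - by rewrite ler_wpM2l ?powR_ge0 ?hC.
rewrite mE le_eqVlt; apply/orP; left; apply/eqP; ring.
Qed.

(** * Fractional powers as mixtures of exponentials *)

Section subordination_kernel.
Context {R : realType}.
Local Notation mu := (@lebesgue_measure R).

Lemma continuous_expR_scale (k : R) : continuous (fun r : R => expR (k * r)).
Proof.
move=> x; apply: continuous_comp; last exact: continuous_expR.
exact: mulrl_continuous.
Qed.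

Lemma integral_expR_abs (e : R) : 0 < e ->
  (\int[mu]_x (expR (- (e * `|x|)))%:E = (2 / e)%:E)%E.
Proof.
move=> e0; rewrite ge0_symfun_integralT; last 3 first.
- by move=> x; exact: expR_ge0.
- move=> x; apply: continuous_comp; last exact: continuous_expR.
  apply: cvgN; apply: cvgMr; exact: norm_continuous.
- by move=> x /=; rewrite normrN.
rewrite (_ : [set x | _] = `[0, +oo[%classic); last first.
  by apply/seteqP; split => x/=; rewrite in_itv/= andbT.
transitivity (2 * \int[mu]_x ((e^-1)%:E * (exponential_pdf e x)%:E))%E.
  congr (_ * _)%E; rewrite integral_mkcond; apply: eq_integral => x _.
  rewrite /exponential_pdf !patchE; case: ifPn => [|_]; last by rewrite mule0.
  rewrite inE /= in_itv /= andbT => x0.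
  by rewrite -EFinM ger0_norm// mulrA mulVf ?gt_eqF// mul1r mulNr.
rewrite ge0_integralZl//=.
- by rewrite integral_exponential_pdf// mule1.
- by apply/measurable_EFinP; exact: measurable_exponential_pdf.
- by move=> x _; rewrite lee_fin exponential_pdf_ge0// ltW.
- by rewrite lee_fin invr_ge0 ltW.
Qed.

Variables (s : R) (M : nat).
Hypotheses (s0 : 0 < s) (sM : s / 2 < M%:R).
Let k := M%:R - s / 2.
Let k0 : 0 < k. Proof. by rewrite subr_gt0. Qed.

Lemma continuous_weight :
  continuous (fun r : R => expR (k * r) / (1 + expR r) ^+ M).
Proof.
move=> x; apply: cvgM; first exact: continuous_expR_scale.
apply: cvgV; first by rewrite expf_neq0// gt_eqF// addr_gt0 ?expR_gt0.
apply: (@continuous_comp _ _ _ (fun r : R => 1 + expR r) (fun z => z ^+ M)).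
  by apply: cvgD; [exact: cvg_cst|exact: continuous_expR].
exact: exprn_continuous.
Qed.

(** For r >= 0 the denominator is at least exp (M r), for r < 0 it is at least 1. *)
Lemma weight_le r :
  expR (k * r) / (1 + expR r) ^+ M <= expR (- (Num.min k (s / 2) * `|r|)).
Proof.
have v0 : 0 < 1 + expR r by rewrite addr_gt0 ?expR_gt0.
rewrite ler_pdivrMr ?exprn_gt0//.
have [r0|r0] := leP 0 r.
  rewrite ger0_norm//; apply: (@le_trans _ _ (expR (- (s / 2 * r)) * expR r ^+ M)).
    by rewrite -expRM_natl -expRD ler_expR /k; lra.
  apply: ler_pM; rewrite ?expR_ge0 ?exprn_ge0 ?expR_ge0//.
    by rewrite ler_expR lerN2 ler_wpM2r// ge_min lexx orbT.
  by rewrite lerXn2r ?nnegrE ?expR_ge0 ?(ltW v0)// lerDr.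
rewrite ltr0_norm// mulrN opprK -[leLHS]mulr1.
apply: ler_pM; rewrite ?expR_ge0//.
  by rewrite ler_expR ler_wnM2r ?ge_min ?lexx// ltW.
by rewrite exprn_ege1// lerDl expR_ge0.
Qed.

Lemma min_rate_gt0 : 0 < Num.min k (s / 2).
Proof. by rewrite lt_min k0 divr_gt0. Qed.

Lemma integral_weight_fin :
  (\int[mu]_r (expR (k * r) / (1 + expR r) ^+ M)%:E < +oo)%E.
Proof.
apply: (@le_lt_trans _ _ (\int[mu]_r (expR (- (Num.min k (s / 2) * `|r|)))%:E)%E).
  apply: ge0_le_integral => //.
  - apply/measurable_EFinP; apply: continuous_measurable_fun.
    exact: continuous_weight.
  - apply/measurable_EFinP; apply: measurableT_comp => //.
    by apply: measurableT_comp => //; apply: measurable_funM.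
  - by move=> r _; rewrite lee_fin weight_le.
by rewrite integral_expR_abs ?ltry// min_rate_gt0.
Qed.

(** The integrand of Euler's integral for Gamma k after the substitution
    t = exp r.  In this variable the scaling t |-> t y is a translation, and no
    singularity at t = 0 remains. *)
Definition gamma_density (r : R) : R := expR (k * r) * expR (- expR r).

Lemma continuous_gamma_density : continuous gamma_density.
Proof.
move=> x; apply: cvgM; first exact: continuous_expR_scale.
apply: continuous_comp; last exact: continuous_expR.
by apply: cvgN; exact: continuous_expR.
Qed.

Lemma gamma_density_ge0 r : 0 <= gamma_density r.
Proof. by rewrite mulr_ge0 ?expR_ge0. Qed.

Lemma measurable_gamma_density :
  measurable_fun setT (gamma_density : measurableTypeR R -> R).
Proof. by apply: continuous_measurable_fun; exact: continuous_gamma_density. Qed.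

Definition gamma_mass : R := \int[mu]_r gamma_density r.

Lemma integral_gamma_density_fin : (\int[mu]_r (gamma_density r)%:E < +oo)%E.
Proof.
have [C C0 hC] := @expR_beats_power R M 1 ltr01.
have mw : measurable_fun setT (fun r : measurableTypeR R =>
    (expR (k * r) / (1 + expR r) ^+ M)%:E).
  apply/measurable_EFinP; apply: continuous_measurable_fun.
  exact: continuous_weight.
have w0 (r : R) : (0 <= (expR (k * r) / (1 + expR r) ^+ M)%:E)%E.
  by rewrite lee_fin divr_ge0 ?expR_ge0// exprn_ge0// addr_ge0 ?expR_ge0//.
apply: (@le_lt_trans _ _
    (\int[mu]_r (C%:E * (expR (k * r) / (1 + expR r) ^+ M)%:E))%E).
  apply: ge0_le_integral => //.
  - by move=> r _; rewrite lee_fin gamma_density_ge0.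
  - by apply/measurable_EFinP; exact: measurable_gamma_density.
  - exact: measurable_funeM.
  - move=> r _; rewrite -EFinM lee_fin /gamma_density mulrCA.
    rewrite ler_wpM2l ?expR_ge0// ler_pdivlMr ?exprn_gt0 ?addr_gt0 ?expR_gt0//.
    by rewrite mulrC; have := hC _ (expR_ge0 r); rewrite mul1r.
rewrite ge0_integralZl//; last by rewrite lee_fin ltW.
by rewrite lte_mul_pinfty ?lee_fin ?ltW// integral_weight_fin.
Qed.

Lemma gamma_massE : (\int[mu]_r (gamma_density r)%:E = gamma_mass%:E)%E.
Proof.
rewrite /gamma_mass /Rintegral fineK// ge0_fin_numE ?integral_gamma_density_fin//.
by apply: integral_ge0 => r _; rewrite lee_fin gamma_density_ge0.
Qed.

Lemma gamma_mass_gt0 : 0 < gamma_mass.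
Proof.
rewrite -lte_fin -gamma_massE.
apply: (@lt_le_trans _ _ (\int[mu]_(r in `[0%R, 1%R]) (expR (- expR 1))%:E)%E).
  rewrite integral_cst//= lebesgue_measure_itv/= lte_fin ltr01 oppr0 adde0 mule1.
  by rewrite lte_fin expR_gt0.
apply: (@le_trans _ _ (\int[mu]_(r in `[0%R, 1%R]) (gamma_density r)%:E)%E).
  apply: ge0_le_integral => //.
  - by apply: measurable_funTS; apply/measurable_EFinP; exact: measurable_gamma_density.
  - move=> r /=; rewrite in_itv/= => /andP[r0 r1]; rewrite lee_fin.
    rewrite -[leLHS]mul1r; apply: ler_pM; rewrite ?expR_ge0//.
      by rewrite -expR0 ler_expR mulr_ge0// ltW.
    by rewrite ler_expR lerN2 ler_expR.
apply: ge0_subset_integral => //.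
  by apply/measurable_EFinP; exact: measurable_gamma_density.
by move=> r _; rewrite lee_fin gamma_density_ge0.
Qed.

(** Translate r by ln y in the integral of [gamma_density]. *)
Lemma subordination_gt0 (y : R) : 0 < y ->
  (\int[mu]_r (expR (k * r) * expR (- (expR r * y)))%:E =
   (y `^ (- k) * gamma_mass)%:E)%E.
Proof.
move=> y0; pose F (r : R) := r + ln y.
have F'E : F^`()%classic = cst 1.
  apply/funext => x; rewrite /F derive1E deriveD// derive_id derive_cst addr0//.
have e1 : (\int[mu]_r (gamma_density r)%:E =
    \int[mu]_r ((y `^ k)%:E * (expR (k * r) * expR (- (expR r * y)))%:E))%E.
  rewrite (increasing_ge0_integration_by_substitutionT (F := F)) ?F'E//.
  - apply: eq_integral => r _; rewrite -EFinM; congr EFin.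
    rewrite -[LHS]/(gamma_density (r + ln y) * 1) mulr1 /gamma_density.
    rewrite mulrDr !expRD lnK ?posrE// mulrCA mulrA; congr (_ * _ * _).
    by rewrite /powR gt_eqF.
  - by move=> a b ab; rewrite /F ltrD2r.
  - by move=> ?; exact: cvg_cst.
  - exact: is_cvg_cst.
  - exact: is_cvg_cst.
  - exact: cvg_addrr_Ny.
  - exact: cvg_addrr.
  - exact: continuous_gamma_density.
  - exact: gamma_density_ge0.
move: e1; rewrite gamma_massE ge0_integralZl//=; last 2 first.
- apply/measurable_EFinP; apply: measurable_funM.
    by apply: continuous_measurable_fun; exact: continuous_expR_scale.
  apply: measurableT_comp => //; apply: measurableT_comp => //.
  by apply: measurable_funM.
- by rewrite lee_fin powR_ge0.
move/(congr1 (fun z => (y `^ (- k))%:E * z)%E).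
by rewrite muleA -!EFinM powRN mulVf ?gt_eqF ?powR_gt0// mul1e => <-.
Qed.

(** Multiplying by y^M turns the negative power y^(-k) into y^(s/2).  Both sides
    vanish at y = 0 because M > 0 and s > 0. *)
Lemma subordination (y : R) : 0 <= y ->
  (\int[mu]_r (expR (k * r) * (y ^+ M * expR (- (expR r * y))))%:E =
   (y `^ (s / 2) * gamma_mass)%:E)%E.
Proof.
rewrite le_eqVlt => /predU1P[<-|y0].
  have Mn0 : (M != 0)%N.
    by apply/eqP => M0; move: sM; rewrite M0 ltNge divr_ge0// ltW.
  rewrite powR0 ?gt_eqF ?divr_gt0// mul0r.
  under eq_integral do rewrite expr0n (negbTE Mn0) mul0r mulr0.
  by rewrite integral0.
under eq_integral do rewrite mulrCA EFinM.
rewrite ge0_integralZl//=; last 2 first.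
- apply/measurable_EFinP; apply: measurable_funM.
    by apply: continuous_measurable_fun; exact: continuous_expR_scale.
  apply: measurableT_comp => //; apply: measurableT_comp => //.
  by apply: measurable_funM.
- by rewrite lee_fin exprn_ge0// ltW.
rewrite subordination_gt0// -EFinM mulrA; congr (_ * _)%:E.
rewrite -powR_mulrn ?ltW// -powRD ?(gt_eqF y0) ?implybT//; congr powR.
by rewrite /k; ring.
Qed.

End subordination_kernel.

(** * The majorant of a fractional derivative of a Gaussian *)

Section fractional_multiplier.
Context {R : realType} {N : nat}.
Variables (P : pred 'I_N) (s : R) (M : nat).
Hypotheses (s0 : 0 < s) (sM : s / 2 < M%:R).
Local Notation mu := (@lebesgue_measure R).
Let k := M%:R - s / 2.
Let dl : R := #|P|%:R / 2.
Let dl0 : 0 <= dl. Proof. by rewrite divr_ge0. Qed.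

Let v_gt0 (r : R) : 0 < 1 + expR r. Proof. by rewrite addr_gt0 ?expR_gt0. Qed.

(** The factor v^(- #|P| / 2 - M) is the size of the transform of y^M exp (- v y)
    for v = 1 + exp r. *)
Definition heat_weight (r : R) : R := expR (k * r) * (1 + expR r) `^ (- dl - M%:R).

(** The part v^(#|P| / 2) is what integration over the block gives back. *)
Lemma heat_weightE r : heat_weight r * (1 + expR r) `^ dl =
  expR (k * r) / (1 + expR r) ^+ M.
Proof.
rewrite /heat_weight -mulrA -powRD ?(gt_eqF (v_gt0 r)) ?implybT//.
by rewrite (_ : _ + dl = - M%:R) ?powRN ?powR_mulrn ?ltW//; ring.
Qed.

Lemma heat_weight_ge0 r : 0 <= heat_weight r.
Proof. by rewrite mulr_ge0 ?expR_ge0 ?powR_ge0. Qed.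

Lemma heat_weight_le r : heat_weight r <= expR (k * r) / (1 + expR r) ^+ M.
Proof.
rewrite -heat_weightE ler_peMr ?heat_weight_ge0//.
apply: (@le_trans _ _ (1 `^ dl)); first by rewrite powR1.
by rewrite ge0_ler_powR// ?nnegrE ?ltW// ltrDl expR_gt0.
Qed.

Lemma measurable_heat_weight :
  measurable_fun setT (heat_weight : measurableTypeR R -> R).
Proof.
apply: measurable_funM.
  by apply: continuous_measurable_fun; exact: continuous_expR_scale.
apply: (measurableT_comp (measurable_powR _)).
by apply: measurable_funD.
Qed.

Definition weight_mass : R := \int[mu]_r (expR (k * r) / (1 + expR r) ^+ M).

Lemma weight_massE :
  (\int[mu]_r (expR (k * r) / (1 + expR r) ^+ M)%:E = weight_mass%:E)%E.
Proof.
rewrite /weight_mass /Rintegral fineK// ge0_fin_numE ?integral_weight_fin//.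
apply: integral_ge0 => r _.
by rewrite lee_fin divr_ge0 ?expR_ge0// exprn_ge0// ltW.
Qed.

Section fixed_block.
Variables (b : R) (a : 'I_N -> R).
Hypotheses (b0 : 0 < b) (a0 : forall i, 0 < a i) (aP : forall i, P i -> a i = b).

Lemma on_block_energy_ge0 x : 0 <= on_block_energy P b x.
Proof.
by rewrite mulr_ge0 ?(ltW b0)// sumr_ge0// => i _; exact: sqr_ge0.
Qed.

Definition heat_kernel (x : 'I_N -> R) (r : R) : R :=
  heat_weight r * expR (- (on_block_energy P b x / (1 + expR r)) / 4).

Lemma heat_kernel_ge0 x r : 0 <= heat_kernel x r.
Proof. by rewrite mulr_ge0 ?expR_ge0 ?heat_weight_ge0. Qed.

Lemma heat_kernel_le x r : heat_kernel x r <= expR (k * r) / (1 + expR r) ^+ M.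
Proof.
apply: le_trans (heat_weight_le r).
rewrite ler_piMr ?heat_weight_ge0// -[leRHS]expR0 ler_expR mulNr oppr_le0.
by rewrite !divr_ge0 ?on_block_energy_ge0// ltW.
Qed.

Lemma measurable_heat_kernel2 :
  measurable_fun setT (fun z : N.-tuple (measurableTypeR R) * measurableTypeR R =>
    heat_kernel (tnth z.1) z.2).
Proof.
apply: measurable_funM.
  exact: (measurableT_comp measurable_heat_weight).
apply: measurableT_comp => //; apply: measurable_funM => //.
apply: measurableT_comp => //; apply: measurable_funM.
  apply: measurable_funM => //.
  exact: (measurableT_comp (measurable_block_square R N P)).
apply: (@measurableT_comp _ _ _ _ _ _ (fun r : measurableTypeR R => (1 + expR r)^-1)) => //.
apply: continuous_measurable_fun => r; apply: cvgV; first by rewrite gt_eqF.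
by apply: cvgD; [exact: cvg_cst|exact: continuous_expR].
Qed.

Lemma measurable_heat_kernel x :
  measurable_fun setT (heat_kernel x : measurableTypeR R -> R).
Proof.
apply: measurable_funM; first exact: measurable_heat_weight.
apply: measurableT_comp => //; apply: measurable_funM => //.
apply: measurableT_comp => //; apply: measurable_funM => //.
apply: continuous_measurable_fun => r; apply: cvgV; first by rewrite gt_eqF.
by apply: cvgD; [exact: cvg_cst|exact: continuous_expR].
Qed.

Lemma integral_heat_kernel_le x :
  (\int[mu]_r (heat_kernel x r)%:E <= weight_mass%:E)%E.
Proof.
rewrite -weight_massE; apply: ge0_le_integral => //.
- by move=> r _; rewrite lee_fin heat_kernel_ge0.
- by apply/measurable_EFinP; exact: measurable_heat_kernel.
- apply/measurable_EFinP; apply: continuous_measurable_fun.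
  exact: continuous_weight.
- by move=> r _; rewrite lee_fin heat_kernel_le.
Qed.

(** A mixture of Gaussians in the block, of variance proportional to
    1 + exp r, times a fixed Gaussian in the other variables.  It decays only
    polynomially in the block. *)
Definition heat_majorant (x : 'I_N -> R) : R :=
  off_block_gaussian P a x * \int[mu]_r heat_kernel x r.

Lemma heat_kernel_integralE x :
  (\int[mu]_r (heat_kernel x r)%:E = (\int[mu]_r heat_kernel x r)%:E)%E.
Proof.
rewrite /Rintegral fineK// ge0_fin_numE.
  exact: le_lt_trans (integral_heat_kernel_le x) (ltry _).
by apply: integral_ge0 => r _; rewrite lee_fin heat_kernel_ge0.
Qed.

Lemma heat_majorant_ge0 x : 0 <= heat_majorant x.
Proof.
rewrite mulr_ge0 ?expR_ge0// Rintegral_ge0// => r _; exact: heat_kernel_ge0.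
Qed.

Lemma heat_majorant_le x : heat_majorant x <= weight_mass.
Proof.
have I0 : 0 <= \int[mu]_r heat_kernel x r.
  by rewrite Rintegral_ge0// => r _; exact: heat_kernel_ge0.
apply: (@le_trans _ _ (\int[mu]_r heat_kernel x r)); last first.
  by rewrite -lee_fin -heat_kernel_integralE integral_heat_kernel_le.
rewrite ler_piMl// -[leRHS]expR0 ler_expR mulNr oppr_le0 divr_ge0// sumr_ge0//.
by move=> i _; rewrite mulr_ge0 ?sqr_ge0// ltW.
Qed.

Lemma measurable_off_block :
  measurable_fun setT (fun t : N.-tuple (measurableTypeR R) =>
    off_block_gaussian P a (tnth t)).
Proof.
apply: measurableT_comp => //; apply: measurable_funM => //.
by apply: measurableT_comp => //; exact: measurable_quadratic.
Qed.

Lemma measurable_heat_majorant :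
  measurable_fun setT (fun t : N.-tuple (measurableTypeR R) =>
    heat_majorant (tnth t)).
Proof.
apply: measurable_funM; first exact: measurable_off_block.
apply: (@measurableT_comp _ _ _ _ _ _ fine); first exact: fine_measurable.
apply: (@measurable_fun_fubini_tonelli_F _ _ _ _ _ mu
  (fun z : N.-tuple (measurableTypeR R) * measurableTypeR R =>
    (heat_kernel (tnth z.1) z.2)%:E)).
  by apply/measurable_EFinP; exact: measurable_heat_kernel2.
by move=> z; rewrite lee_fin heat_kernel_ge0.
Qed.

(** Exchange the integrals: for fixed r the function is a Gaussian, its integral
    in the block gains v^(#|P| / 2), and what remains is the integrable weight
    exp (k r) / (1 + exp r)^M. *)
Lemma integral_heat_majorant :
  (\int[lebesgue_tuple R N]_t (heat_majorant (tnth t))%:E <=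
   (Num.sqrt (4 * pi) ^+ N * weight_mass * \prod_(i < N) (Num.sqrt (a i))^-1)%:E)%E.
Proof.
have mo : measurable_fun setT (fun z : N.-tuple (measurableTypeR R) * measurableTypeR R =>
    (off_block_gaussian P a (tnth z.1) * heat_kernel (tnth z.1) z.2)%:E).
  apply/measurable_EFinP; apply: measurable_funM; last exact: measurable_heat_kernel2.
  exact: (measurableT_comp measurable_off_block).
have o0 x : 0 <= off_block_gaussian P a x by exact: expR_ge0.
under eq_integral => t _.
  rewrite /heat_majorant EFinM -heat_kernel_integralE -ge0_integralZl//=; last 3 first.
  - by apply/measurable_EFinP; exact: measurable_heat_kernel.
  - by move=> r _; rewrite lee_fin heat_kernel_ge0.
  - by rewrite lee_fin.
  under eq_integral do rewrite -EFinM.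
  over.
rewrite (fubini_tonelli _ mo)/=; last first.
  by move=> z; rewrite lee_fin mulr_ge0 ?heat_kernel_ge0.
pose A : R := Num.sqrt (4 * pi) ^+ N * \prod_(i < N) (Num.sqrt (a i))^-1.
have A0 : 0 <= A.
  apply: mulr_ge0; first by rewrite exprn_ge0 ?sqrtr_ge0.
  by apply: prodr_ge0 => i _; rewrite invr_ge0 sqrtr_ge0.
have inner (r : R) : (\int[lebesgue_tuple R N]_t
    (off_block_gaussian P a (tnth t) * heat_kernel (tnth t) r)%:E <=
    (A * (expR (k * r) / (1 + expR r) ^+ M))%:E)%E.
  (* For fixed r the integrand is a Gaussian with these coefficients. *)
  pose c i := if P i then b / (2 * (1 + expR r)) else a i.
  have c0 i : 0 < c i by rewrite /c; case: ifP => // _; rewrite divr_gt0 ?mulr_gt0.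
  have cE t : off_block_gaussian P a (tnth t) * heat_kernel (tnth t) r =
      heat_weight r * gaussian c t.
    rewrite /heat_kernel mulrCA; congr (_ * _).
    rewrite /off_block_gaussian /gaussian /on_block_energy -expRD; congr expR.
    rewrite [in RHS](bigID P) /= [in RHS]addrC opprD mulrDl.
    congr (- _ / _ + _); first by apply: eq_bigr => i /negbTE; rewrite /c => ->.
    rewrite [in RHS](eq_bigr (fun i => b / (2 * (1 + expR r)) * tnth t i ^+ 2)).
      2: by move=> i; rewrite /c => ->.
    by rewrite -mulr_sumr; field; rewrite gt_eqF.
  under eq_integral do rewrite cE EFinM.
  rewrite ge0_integralZl//=; last 3 first.
  - by apply/measurable_EFinP; exact: measurable_ngaussian.
  - by move=> t _; rewrite lee_fin gaussian_ge0.
  - by rewrite lee_fin heat_weight_ge0.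
  rewrite integral_ngaussian// -EFinM lee_fin -heat_weightE mulrCA.
  rewrite ler_wpM2l ?heat_weight_ge0// /A.
  rewrite -[in _ ^+ N](card_ord N) -prodr_const -big_split /=.
  have -> : (1 + expR r) `^ dl =
      \prod_(i < N) (if P i then (1 + expR r) `^ 2^-1 else 1).
    by rewrite -big_mkcond prodr_const -powR_mulrn ?powR_ge0// -powRrM mulrC.
  rewrite -big_split /=; apply: ler_prod => i _; rewrite sqrtr_ge0 /c /=.
  have pi0 := @pi_gt0 R.
  case: ifPn => Pi.
    rewrite (aP _ Pi) powR12_sqrt ?(ltW (v_gt0 r))// -sqrtrV ?(ltW b0)//.
    rewrite -!sqrtrM ?mulr_ge0 ?invr_ge0 ?(ltW b0) ?(ltW pi0)//.
    rewrite le_eqVlt; apply/orP; left; apply/eqP; congr Num.sqrt.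
    by field; rewrite !gt_eqF.
  rewrite mulr1 -sqrtrV ?(ltW (a0 i))// -sqrtrM ?mulr_ge0 ?(ltW pi0)//.
  rewrite ler_sqrt; last by rewrite !mulr_ge0 ?invr_ge0 ?(ltW pi0) ?(ltW (a0 i)).
  by rewrite ler_wpM2r ?invr_ge0 ?(ltW (a0 i))// ler_wpM2r ?(ltW pi0)// ler_nat.
apply: (@le_trans _ _ (\int[mu]_r (A%:E * (expR (k * r) / (1 + expR r) ^+ M)%:E))%E).
  apply: ge0_le_integral => //.
  - move=> r _; apply: integral_ge0 => t _; rewrite lee_fin.
    by rewrite mulr_ge0 ?heat_kernel_ge0.
  - apply: (@measurable_fun_fubini_tonelli_G _ _ _ _ _ _ _ mo).
    by move=> z; rewrite lee_fin mulr_ge0 ?heat_kernel_ge0.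
  - apply: measurable_funeM; apply/measurable_EFinP; apply: continuous_measurable_fun.
    exact: continuous_weight.
rewrite ge0_integralZl//=; last first.
  apply/measurable_EFinP; apply: continuous_measurable_fun.
  exact: continuous_weight.
by rewrite weight_massE -EFinM lee_fin /A mulrAC.
Qed.

End fixed_block.
End fractional_multiplier.

(** * Exchanging the mixture and the Fourier integral *)

Section fubini_argument.
Context {R : realType} {N : nat}.
Variables (P : pred 'I_N) (s : R) (M : nat).
Hypotheses (s0 : 0 < s) (sM : s / 2 < M%:R).
Local Notation mu := (@lebesgue_measure R).
Local Notation nu := (lebesgue_tuple R N).
Let k := M%:R - s / 2.
Let v_gt0 (r : R) : 0 < 1 + expR r. Proof. by rewrite addr_gt0 ?expR_gt0. Qed.

Variables (b : R) (a : 'I_N -> R).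
Hypotheses (b0 : 0 < b) (a0 : forall i, 0 < a i) (aP : forall i, P i -> a i = b).
Variables (x : 'I_N -> R) (u : R).

Definition subordinated (z : measurableTypeR R * N.-tuple (measurableTypeR R)) : R :=
  expR (k * z.1) * block_osc P b a x u M (1 + expR z.1) z.2.

Lemma subordinatedE r t : subordinated (r, t) =
  expR (k * r) * (block_energy P b t ^+ M * expR (- (expR r * block_energy P b t))) *
  (gaussian (block_coef P b a 1) t * cos (pairing x t + u)).
Proof.
by rewrite /subordinated /block_osc /= gaussian_block_coefD//; ring.
Qed.

Lemma measurable_subordinated : measurable_fun setT subordinated.
Proof.
rewrite (_ : subordinated = fun z => subordinated (z.1, z.2)); last first.
  by apply/funext => -[].
under eq_fun do rewrite subordinatedE.
have mE := @measurable_block_energy R N P b.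
have me := measurableT_comp mE (@measurable_snd _ _ (measurableTypeR R) _).
apply: measurable_funM.
  apply: measurable_funM.
    apply: measurableT_comp => //; exact: measurable_funM.
  apply: measurable_funM; first exact: measurable_funX.
  apply: measurableT_comp => //; apply: measurableT_comp => //.
  apply: measurable_funM => //; exact: measurableT_comp.
apply: measurable_funM.
  exact: (measurableT_comp (measurable_ngaussian R N _)).
exact: (measurableT_comp (measurable_cos_pairing R N x u)).
Qed.

(** The absolute value of the integrand is at most itself with x = 0 and u = 0,
    so [block_integral_bound] at that point also bounds the absolute integral. *)
Lemma integrable_subordinated :
  (mu \x nu)%E.-integrable setT (EFin \o subordinated).
Proof.
have mH : measurable_fun setT (EFin \o subordinated).
  by apply/measurable_EFinP; exact: measurable_subordinated.
apply/(integrable12ltyP mu nu mH).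
have [C C0 hC] := block_integral_bound R N P M.
pose A := C * \prod_(i < N) Num.sqrt (a i).
have A0 : 0 <= A.
  by rewrite mulr_ge0 ?(ltW C0)// prodr_ge0// => i _; rewrite sqrtr_ge0.
have inner (r : R) : (\int[nu]_t `|(subordinated (r, t))%:E| <=
    (A * (expR (k * r) / (1 + expR r) ^+ M))%:E)%E.
  (* At x = 0 and u = 0 the cosine is 1. *)
  pose g t := block_osc P b a (fun=> 0) 0 M (1 + expR r) t.
  have gE t : g t = block_energy P b t ^+ M * gaussian (block_coef P b a (1 + expR r)) t.
    rewrite /g /block_osc /pairing big1 ?addr0 ?cos0 ?mulr1// => i _.
    by rewrite mul0r.
  have intg : nu.-integrable setT (EFin \o g) by exact: integrable_block_osc.
  apply: (@le_trans _ _ (\int[nu]_t ((expR (k * r))%:E * (g t)%:E))%E).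
    apply: ge0_le_integral => //.
    - apply: measurableT_comp => //; apply/measurable_EFinP.
      exact: (measurableT_comp measurable_subordinated (measurable_pair1 r)).
    - apply: measurable_funeM; exact: (measurable_int _ intg).
    - move=> t _; rewrite -EFinM abse_EFin lee_fin /subordinated /= normrM.
      rewrite (ger0_norm (expR_ge0 _)) ler_wpM2l ?expR_ge0// gE.
      exact: block_osc_le.
  rewrite integralZl//= -[X in (_ * X <= _)%E]fineK; last first.
    exact: (integrable_fin_num measurableT intg).
  rewrite -EFinM lee_fin (mulrCA A) ler_wpM2l ?expR_ge0//.
  rewrite -[X in X <= _]/(block_integral P b a (fun=> 0) 0 M (1 + expR r)).
  apply: le_trans (ler_norm _) _; apply: le_trans (hC _ _ _ _ _ _ _ _ _) _ => //.
  rewrite -/A (_ : off_block_gaussian _ _ _ = 1); last first.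
    by rewrite /off_block_gaussian big1 ?oppr0 ?mul0r ?expR0// => i _; rewrite expr0n mulr0.
  rewrite mulr1 ler_wpM2l// (_ : on_block_energy _ _ _ = 0); last first.
    by rewrite /on_block_energy big1 ?mulr0// => i _; rewrite expr0n.
  rewrite mul0r oppr0 mul0r expR0 mulr1 -powR_mulrn ?(ltW (v_gt0 r))// -powRN.
  by rewrite ler_powR// ?lerDl ?expR_ge0// gerDr oppr_le0 divr_ge0.
apply: (@le_lt_trans _ _ (\int[mu]_r (A%:E * (expR (k * r) / (1 + expR r) ^+ M)%:E))%E).
  apply: ge0_le_integral => //.
  - by move=> r _; apply: integral_ge0 => t _; exact: abse_ge0.
  - apply: (@measurable_fun_fubini_tonelli_F _ _ _ _ _ nu (abse \o (EFin \o subordinated))).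
      exact: measurableT_comp.
    by move=> z; exact: abse_ge0.
  - apply: measurable_funeM; apply/measurable_EFinP; apply: continuous_measurable_fun.
    exact: continuous_weight.
  - by move=> r _; exact: inner.
rewrite ge0_integralZl//=; last first.
  apply/measurable_EFinP; apply: continuous_measurable_fun.
  exact: continuous_weight.
by rewrite weight_massE// -EFinM ltry.
Qed.

Definition fractional_gaussian (t : N.-tuple R) : R :=
  block_energy P b t `^ (s / 2) *
    (gaussian (block_coef P b a 1) t * cos (pairing x t + u)).

Lemma integrable_fractional_gaussian :
  nu.-integrable setT (EFin \o fractional_gaussian).
Proof.
have [C C0 hC] := expR_beats_power R M _ (divr_gt0 (@ltr01 R) (@ltr0Sn R 1)).
apply: (integrable_ngaussian_dominated R N C (block_coef P b a (1 / 2))).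
- by move=> i; exact: block_coef_gt0.
- apply: measurable_funM.
    by apply: (measurableT_comp (measurable_powR _)); exact: measurable_block_energy.
  apply: measurable_funM; [exact: measurable_ngaussian|exact: measurable_cos_pairing].
- move=> t; rewrite /fractional_gaussian normrM (ger0_norm (powR_ge0 _ _)).
  have y0 : 0 <= block_energy P b t by exact: block_energy_ge0.
  apply: (@le_trans _ _ ((1 + block_energy P b t) ^+ M *
      gaussian (block_coef P b a (1 / 2 + 1 / 2)) t)).
    rewrite -splitr; apply: ler_pM; rewrite ?powR_ge0//.
      rewrite -powR_mulrn ?addr_ge0//.
      apply: (@le_trans _ _ ((1 + block_energy P b t) `^ (s / 2))).
        by rewrite ge0_ler_powR ?nnegrE ?addr_ge0// ?lerDr// divr_ge0// ltW.
      by rewrite ler_powR ?lerDl// ltW.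
    by rewrite normrM ger0_norm ?gaussian_ge0// ler_piMr ?gaussian_ge0 ?normr_cos_le1.
  rewrite gaussian_block_coefD// mulrA ler_wpM2r ?gaussian_ge0//.
  exact: hC.
Qed.

(** Integrating [subordinated] first in r gives the fractional power by
    [subordination]; integrating first in t gives a [block_integral]. *)
Lemma fubini_fractional_gaussian :
  (gamma_mass s M * \int[nu]_t fractional_gaussian t)%:E =
  (\int[mu]_r (expR (k * r) * block_integral P b a x u M (1 + expR r))%:E)%E.
Proof.
have intf := integrable_fractional_gaussian.
have -> : (gamma_mass s M * \int[nu]_t fractional_gaussian t)%:E =
    (\int[nu]_t ((gamma_mass s M)%:E * (fractional_gaussian t)%:E))%E.
  rewrite integralZl// EFinM; congr (_ * _)%E.
  by rewrite /Rintegral fineK//; exact: (integrable_fin_num measurableT intf).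
have := Fubini integrable_subordinated.
move=> /(fun h => esym h) => h.
transitivity (\int[nu]_t \int[mu]_r (subordinated (r, t))%:E)%E; last first.
  rewrite h; apply: eq_integral => r _; rewrite EFinM /block_integral /Rintegral.
  have ib := integrable_block_osc P b a b0 a0 x u M _ (v_gt0 r).
  rewrite fineK; last exact: (integrable_fin_num measurableT ib).
  by rewrite -integralZl.
apply: eq_integral => t _; rewrite -EFinM.
have y0 : 0 <= block_energy P b t by exact: block_energy_ge0.
have sub := subordination s M s0 sM _ y0.
under [RHS]eq_integral do rewrite subordinatedE EFinM.
rewrite integralZr//=; first by rewrite sub -EFinM /fractional_gaussian; congr EFin; ring.
apply/integrableP; split.
  apply/measurable_EFinP; apply: measurable_funM.
    by apply: continuous_measurable_fun; exact: continuous_expR_scale.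
  apply: measurable_funM => //; apply: measurableT_comp => //.
  by apply: measurableT_comp => //; apply: measurable_funM.
under eq_integral => r _.
  rewrite /= ger0_norm; last by rewrite !mulr_ge0 ?exprn_ge0 ?expR_ge0.
  over.
by rewrite sub ltry.
Qed.

Lemma fractional_gaussian_le (C : R) :
  (forall v : R, 0 < v -> `|block_integral P b a x u M v| <=
    C * off_block_gaussian P a x *
    (v `^ (- (#|P|%:R / 2) - M%:R) *
       expR (- (on_block_energy P b x / v) / 4))) ->
  gamma_mass s M * `|\int[nu]_t fractional_gaussian t| <= C * heat_majorant P s M b a x.
Proof.
move=> hC; have G0 := gamma_mass_gt0 s M s0 sM.
rewrite -{1}(ger0_norm (ltW G0)) -normrM -lee_fin -abse_EFin.
rewrite fubini_fractional_gaussian.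
have mb : measurable_fun setT (fun r : measurableTypeR R =>
    (expR (k * r) * block_integral P b a x u M (1 + expR r))%:E).
  have := measurable_fubini_F integrable_subordinated.
  apply: eq_measurable_fun => r _; rewrite /fubini_F EFinM /block_integral /Rintegral.
  have ib := integrable_block_osc P b a b0 a0 x u M _ (v_gt0 r).
  rewrite fineK; last exact: (integrable_fin_num measurableT ib).
  by rewrite -integralZl.
apply: le_trans (le_abse_integral _ measurableT mb) _.
rewrite /heat_majorant mulrA EFinM -heat_kernel_integralE//.
have K0 : 0 <= C * off_block_gaussian P a x.
  have := hC _ ltr01; rewrite -[X in _ <= X -> _]/(_ * (_ * _)) => h.
  have h1 := le_trans (normr_ge0 _) h.
  by move: h1; rewrite pmulr_lge0// mulr_gt0 ?expR_gt0 ?powR_gt0.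
rewrite -ge0_integralZl//=; last 2 first.
- by apply/measurable_EFinP; exact: measurable_heat_kernel.
- by move=> r _; rewrite lee_fin heat_kernel_ge0.
apply: ge0_le_integral => //.
- apply/measurable_EFinP; apply: measurableT_comp => //; exact/measurable_EFinP.
- by apply: measurable_funeM; apply/measurable_EFinP; exact: measurable_heat_kernel.
- move=> r _; rewrite -EFinM lee_fin normrM (ger0_norm (expR_ge0 _)).
  rewrite /heat_kernel /heat_weight -/k.
  apply: (@le_trans _ _ (expR (k * r) * (C * off_block_gaussian P a x *
    ((1 + expR r) `^ (- (#|P|%:R / 2) - M%:R) *
       expR (- (on_block_energy P b x / (1 + expR r)) / 4))))).
    by rewrite ler_wpM2l ?expR_ge0// hC.
  rewrite le_eqVlt; apply/orP; left; apply/eqP; ring.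
Qed.

End fubini_argument.

Definition block_norm {R : realType} {N : nat} (P : pred 'I_N) (t : N.-tuple R) : R :=
  Num.sqrt (\sum_(i < N | P i) tnth t i ^+ 2).

Definition fractional_integrand {R : realType} {N : nat} (P : pred 'I_N) (s : R)
    (a x : 'I_N -> R) (u : R) (t : N.-tuple R) : R :=
  block_norm P t `^ s *
    (gaussian (fun i => (a i)^-1) t * cos (pairing x t + u)).

Lemma fractional_integrandE (R : realType) (N : nat) (P : pred 'I_N) (s : R)
    (b : R) (a x : 'I_N -> R) (u : R) (t : N.-tuple R) :
  0 < s -> 0 < b -> (forall i, P i -> a i = b) ->
  fractional_integrand P s a x u t =
  (2 * b) `^ (s / 2) * fractional_gaussian P s b a x u t.
Proof.
move=> s0 b0 aP; have S0 : 0 <= \sum_(i < N | P i) tnth t i ^+ 2.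
  by apply: sumr_ge0 => i _; exact: sqr_ge0.
have b2 : 0 < 2 * b by rewrite mulr_gt0.
rewrite /fractional_integrand /fractional_gaussian [RHS]mulrA; congr (_ * _).
  rewrite /block_norm -powR12_sqrt// -powRrM (mulrC 2^-1).
  rewrite -powRM ?(ltW b2) ?divr_ge0 ?(ltW b2)//.
  by rewrite /block_energy mulrCA mulfV ?mulr1 ?gt_eqF.
rewrite (_ : (fun i => (a i)^-1) = block_coef P b a 1)//.
by apply/funext => i; rewrite /block_coef; case: ifPn => // /aP ->; rewrite div1r.
Qed.

Lemma integrable_fractional_integrand (R : realType) (N : nat) (P : pred 'I_N) (s : R)
    (b : R) (a x : 'I_N -> R) (u : R) :
  0 < s -> 0 < b -> (forall i, 0 < a i) -> (forall i, P i -> a i = b) ->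
  (lebesgue_tuple R N).-integrable setT (EFin \o fractional_integrand P s a x u).
Proof.
move=> s0 b0 a0 aP.
have h := archi_boundP (ltW (divr_gt0 s0 (@ltr0Sn R 1))).
have := integrableZl measurableT ((2 * b) `^ (s / 2))
  (integrable_fractional_gaussian P s _ s0 h b a b0 a0 x u).
apply: eq_integrable => // t _; rewrite /= -EFinM.
by rewrite -fractional_integrandE.
Qed.

(** As W is bounded and integrable, this is an L^oo and an L^1 estimate of the
    fractional derivative of order s, in the block P, of the Gaussian with
    coefficients a.  The constant does not depend on a: this uniformity replaces the change of
    variables under dilations. *)
Lemma fractional_gaussian_bound (R : realType) (N : nat) (P : pred 'I_N) (s : R) :
  0 < s ->
  exists2 C : R, 0 < C & forall (b : R) (a : 'I_N -> R),
    0 < b -> (forall i, 0 < a i) -> (forall i, P i -> a i = b) ->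
    exists W : N.-tuple (measurableTypeR R) -> R,
      [/\ measurable_fun setT W,
          forall x, 0 <= W x <= C,
          (\int[lebesgue_tuple R N]_x (W x)%:E <=
             (C * \prod_(i < N) (Num.sqrt (a i))^-1)%:E)%E &
          forall x u,
            `|\int[lebesgue_tuple R N]_t fractional_integrand P s a (tnth x) u t| <=
            C * b `^ (s / 2) * \prod_(i < N) Num.sqrt (a i) * W x].
Proof.
move=> s0; have sM := archi_boundP (ltW (divr_gt0 s0 (@ltr0Sn R 1))).
set M := Num.bound _ in sM.
have [C C0 hC] := block_integral_bound R N P M.
have G0 := gamma_mass_gt0 s M s0 sM.
(* The factor 2^(s/2) comes from |t_P|^2 = 2 b y. *)
pose C1 := 2 `^ (s / 2) * C / gamma_mass s M.
pose T := weight_mass s M; pose C3 := Num.sqrt (4 * pi) ^+ N * T.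
have T0 : 0 <= T.
  rewrite Rintegral_ge0// => r _; rewrite divr_ge0 ?expR_ge0// exprn_ge0//.
have C10 : 0 < C1 by rewrite divr_gt0// mulr_gt0// powR_gt0.
have C30 : 0 <= C3 by rewrite mulr_ge0// exprn_ge0// sqrtr_ge0.
exists (C1 + T + C3); first by rewrite -addrA ltr_pwDl// addr_ge0.
move=> b a b0 a0 aP; exists (fun t => heat_majorant P s M b a (tnth t)); split.
- exact: measurable_heat_majorant.
- move=> x; rewrite heat_majorant_ge0//=; apply: le_trans (heat_majorant_le _ _ _ _ _ _ _ _ _ _) _ => //.
  by rewrite -/T addrAC lerDr addr_ge0// ltW.
- apply: le_trans (integral_heat_majorant P s M s0 sM b a b0 a0 aP) _.
  rewrite lee_fin ler_wpM2r//.
    by apply: prodr_ge0 => i _; rewrite invr_ge0 sqrtr_ge0.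
  by rewrite -/C3 lerDr addr_ge0// ltW.
- move=> x u.
  have := fractional_gaussian_le P s M s0 sM b a b0 a0 aP (tnth x) u
    (C * \prod_(i < N) Num.sqrt (a i)) (fun v v0 => hC b a (tnth x) u v b0 a0 aP v0).
  have if0 := integrable_fractional_gaussian P s M s0 sM b a b0 a0 (tnth x) u.
  under [in X in _ -> X]eq_Rintegral do rewrite (fractional_integrandE _ _ _ _ b)//.
  rewrite RintegralZl// normrM (ger0_norm (powR_ge0 _ _)) powRM ?(ltW b0)//.
  set I := `|_|; set W := heat_majorant _ _ _ _ _ _; set A := \prod_(_ < _) _ => h.
  have W0 : 0 <= W by exact: heat_majorant_ge0.
  have A0 : 0 <= A by apply: prodr_ge0 => i _; rewrite sqrtr_ge0.
  apply: (@le_trans _ _ (C1 * b `^ (s / 2) * A * W)); last first.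
    do 3 (apply: ler_wpM2r; first by rewrite ?powR_ge0).
    by rewrite -addrA lerDl addr_ge0.
  rewrite /C1 -(ler_pM2l G0).
  rewrite (_ : gamma_mass s M * (2 `^ (s / 2) * b `^ (s / 2) * I) =
    2 `^ (s / 2) * b `^ (s / 2) * (gamma_mass s M * I)); last by ring.
  rewrite [leRHS](_ : _ = 2 `^ (s / 2) * b `^ (s / 2) * (C * A * W)); last first.
    by field; rewrite gt_eqF.
  by rewrite ler_wpM2l// mulr_ge0// powR_ge0.
Qed.

(** * Lebesgue norms of lacunary sums *)

(** Young's inequality applied to x and y^(p - 1); this is the tangent line bound
    for the convex function of exponent p. *)
Lemma powR_increment_le (R : realType) (p x y : R) :
  1 <= p -> 0 <= x -> x <= y ->
  y `^ p - x `^ p <= p * (y - x) * y `^ (p - 1).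
Proof.
rewrite le_eqVlt => /predU1P[<- x0 xy|p1 x0 xy].
  by rewrite !powRr1 ?(le_trans x0 xy)// subrr powRr0 mul1r mulr1.
have y0 := le_trans x0 xy.
have p0 : 0 < p by rewrite (lt_trans ltr01).
have pm : 0 < p - 1 by rewrite subr_gt0.
have pq : p^-1 + (p / (p - 1))^-1 = 1 by field; rewrite !gt_eqF.
have := conjugate_powR x0 (powR_ge0 y (p - 1)) p0 (divr_gt0 p0 pm) pq.
rewrite -powRrM (_ : (p - 1) * (p / (p - 1)) = p); last by field; rewrite gt_eqF.
have yE : y `^ p = y * y `^ (p - 1).
  have [->|yn0] := eqVneq y 0; first by rewrite !powR0 ?gt_eqF// mul0r.
  by rewrite -{2}(powRr1 y0) -powRD ?yn0 ?implybT//; congr powR; ring.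
rewrite -(ler_pM2l p0) => h.
have {}h : p * (x * y `^ (p - 1)) <= x `^ p + (p - 1) * y `^ p.
  apply: le_trans h _; rewrite le_eqVlt; apply/orP; left; apply/eqP.
  by field; rewrite !gt_eqF.
rewrite -subr_ge0.
rewrite (_ : _ - _ = x `^ p + (p - 1) * y `^ p - p * (x * y `^ (p - 1))).
  by rewrite subr_ge0.
by rewrite yE; ring.
Qed.

Lemma geometric_sum_le (R : realType) (q : R) (n : nat) : 1 < q ->
  \sum_(i < n.+1) q ^+ i <= q / (q - 1) * q ^+ n.
Proof.
move=> q1; have q10 : 0 < q - 1 by rewrite subr_gt0.
elim: n => [|n IH].
  rewrite big_ord1 expr0 mulr1 ler_pdivlMr//; lra.
rewrite big_ord_recr /=; apply: (le_trans (lerD IH (lexx _))).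
rewrite le_eqVlt; apply/orP; left; apply/eqP; rewrite exprS.
by field; rewrite gt_eqF.
Qed.

Section lacunary.
Context d (T : measurableType d) (R : realType) (mu : {measure set T -> \bar R}).

(** Since the bounds on B k grow geometrically, the sum up to k is bounded by a
    multiple of the bound on B k alone.  Telescoping the p-th powers of the
    partial sums with [powR_increment_le], each increment is therefore at most
    B k times a constant times exp (k (p - 1) / p). *)
Lemma lacunary_powR_le (p C : R) (B : nat -> T -> R) (K : nat) x :
  1 <= p -> 0 < C -> (forall k, 0 <= B k x <= C * expR (k%:R / p)) ->
  (\sum_(k < K) B k x) `^ p <=
  \sum_(k < K) p * (C * (expR p^-1 / (expR p^-1 - 1))) `^ (p - 1) *
     expR (k%:R * (1 - p^-1)) * B k x.
Proof.
move=> p1 C0 hB; have p0 : 0 < p by rewrite (lt_le_trans ltr01).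
set q := expR p^-1; have q1 : 1 < q by rewrite expR_gt1 invr_gt0.
have q10 : 0 < q - 1 by rewrite subr_gt0.
have D0 : 0 < C * (q / (q - 1)) by rewrite mulr_gt0// divr_gt0// expR_gt0.
have S0 n : 0 <= \sum_(k < n) B k x.
  by apply: sumr_ge0 => k _; have /andP[] := hB k.
elim: K => [|K IH]; first by rewrite !big_ord0 powR0// gt_eqF.
rewrite [in leRHS]big_ord_recr /=; apply: le_trans (lerD IH (lexx _)).
rewrite addrC -lerBlDr.
have Sle : \sum_(k < K) B k x <= \sum_(k < K.+1) B k x.
  by rewrite big_ord_recr /= lerDl; have /andP[] := hB K.
apply: le_trans (powR_increment_le _ _ _ _ p1 (S0 K) Sle) _.
rewrite {1}big_ord_recr /= [X in p * X](_ : _ = B K x); last by ring.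
rewrite -!mulrA ler_wpM2l ?(ltW p0)// mulrC mulrA.
have /andP[BK0 _] := hB K.
rewrite ler_wpM2r//.
have -> : expR (K%:R * (1 - p^-1)) = (q ^+ K) `^ (p - 1).
  rewrite /q -expRM_natl /powR gt_eqF ?expR_gt0// expRK; congr expR.
  by field; rewrite gt_eqF.
rewrite -powRM ?(ltW D0) ?exprn_ge0 ?expR_ge0//.
apply: ge0_ler_powR; [by rewrite subr_ge0|exact: S0| |].
  by rewrite nnegrE mulr_ge0 ?(ltW D0)// exprn_ge0// expR_ge0.
apply: (@le_trans _ _ (\sum_(k < K.+1) C * q ^+ k)).
  apply: ler_sum => k _; have /andP[_] := hB k.
  by rewrite /q -expRM_natl.
by rewrite -mulr_sumr -mulrA ler_wpM2l ?(ltW C0)// geometric_sum_le.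
Qed.

(** The sup bound to the power p - 1 times the integral bound is a constant for
    every k, as (k / p) (p - 1) + k / p - k = 0; so each piece contributes the same
    amount. *)
Lemma integral_lacunary_le (p C : R) (B : nat -> T -> R) (K : nat) :
  1 <= p -> 0 < C -> (forall k, measurable_fun setT (B k)) ->
  (forall k x, 0 <= B k x <= C * expR (k%:R / p)) ->
  (forall k, (\int[mu]_x (B k x)%:E <= (C * expR (k%:R / p - k%:R))%:E)%E) ->
  (\int[mu]_x ((\sum_(k < K) B k x) `^ p)%:E <=
   (p * (C * (expR p^-1 / (expR p^-1 - 1))) `^ (p - 1) * C * K%:R)%:E)%E.
Proof.
move=> p1 C0 mB hB iB; have p0 : 0 < p by rewrite (lt_le_trans ltr01).
set D := p * _ `^ _.
have D0 : 0 <= D by rewrite mulr_ge0 ?powR_ge0// ltW.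
have DE (r : R) : 0 <= D * expR r by apply: mulr_ge0; rewrite ?expR_ge0.
apply: (@le_trans _ _ (\int[mu]_x
    (\sum_(k < K) ((D * expR (k%:R * (1 - p^-1)))%:E * (B k x)%:E)))%E).
  apply: ge0_le_integral => //.
  - by move=> x _; rewrite lee_fin powR_ge0.
  - apply/measurable_EFinP; apply: (measurableT_comp (measurable_powR _)).
    exact: measurable_sum.
  - apply: emeasurable_sum => k; apply: measurable_funeM.
    by apply/measurable_EFinP; exact: mB.
  - move=> x _; rewrite (eq_bigr (fun k : 'I_K =>
      (D * expR (k%:R * (1 - p^-1)) * B k x)%:E)); last by move=> k _; rewrite EFinM.
    by rewrite sumEFin lee_fin; exact: lacunary_powR_le.
rewrite ge0_integral_sum//; last 2 first.
- by move=> k; apply: measurable_funeM; apply/measurable_EFinP; exact: mB.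
- move=> k x _; rewrite -EFinM lee_fin; apply: mulr_ge0 => //.
  by have /andP[] := hB k x.
apply: (@le_trans _ _ (\sum_(k < K) (D * C)%:E)%E).
  apply: lee_sum => k _; rewrite ge0_integralZl//; last 3 first.
  - by apply/measurable_EFinP; exact: mB.
  - by move=> x _; rewrite lee_fin; have /andP[] := hB k x.
  - by rewrite lee_fin.
  apply: (@le_trans _ _ ((D * expR (k%:R * (1 - p^-1)))%:E *
     (C * expR (k%:R / p - k%:R))%:E)%E).
    by apply: lee_wpmul2l; rewrite ?lee_fin.
  rewrite -EFinM lee_fin mulrACA -expRD.
  rewrite (_ : _ + (_ - _) = 0) ?expR0 ?mulr1//; ring.
by rewrite sumEFin lee_fin sumr_const card_ord mulr_natr.
Qed.

End lacunary.

Definition lacunary_exponent {R : realType} (p : \bar R) : R :=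
  if p == +oo%E then 1 else fine p^-1%E.

Section lacunary_norm.
Context d (T : measurableType d) (R : realType) (mu : {measure set T -> \bar R}).

(** The integral of a nonnegative function is the supremum of the integrals of
    the simple functions below it. *)
Lemma ge0_le_integral_nonmeasurable (f g : T -> \bar R) :
  (forall x, 0 <= f x)%E -> (forall x, f x <= g x)%E ->
  (\int[mu]_x f x <= \int[mu]_x g x)%E.
Proof.
move=> f0 fg; rewrite !ge0_integralTE//; last first.
  by move=> x; exact: le_trans (f0 x) (fg x).
apply: ge_ereal_sup => _ [h hf <-]; apply: ereal_sup_ubound; exists h => // x.
exact: le_trans (hf x) (fg x).
Qed.

(** The gain over the triangle inequality: the exponent is 1 / p instead of 1
    when p is finite. *)
Lemma Lnorm_lacunary_le (p : \bar R) (C : R) : (1 <= p)%E -> 0 < C ->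
  exists2 D : R, 0 < D & forall (K : nat) (f : T -> R) (B : nat -> T -> R),
    (forall k, measurable_fun setT (B k)) ->
    (forall k x, 0 <= B k x <= C * expR (k%:R * fine p^-1%E)) ->
    (forall k, (\int[mu]_x (B k x)%:E <=
                  (C * expR (k%:R * fine p^-1%E - k%:R))%:E)%E) ->
    (forall x, `|f x| <= \sum_(k < K) B k x) ->
    (Lnorm mu p (EFin \o f) <= (D * K%:R `^ lacunary_exponent p)%:E)%E.
Proof.
case: p => [p| |] //; last first.
  move=> _ C0; exists C => // K f B mB hB iB fB.
  rewrite /lacunary_exponent eqxx powRr1// unlock.
  have CK : (0 <= (C * K%:R)%:E)%E by rewrite lee_fin mulr_ge0// ltW.
  case: ifPn => // _; apply/ess_supP; apply: nearW => x /=.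
  rewrite lee_fin; apply: le_trans (fB x) _.
  apply: (@le_trans _ _ (\sum_(k < K) C)).
    by apply: ler_sum => k _; have /andP[_] := hB k x; rewrite mulr0 expR0 mulr1.
  by rewrite sumr_const card_ord mulr_natr.
rewrite lee_fin => p1 C0; have p0 : 0 < p by rewrite (lt_le_trans ltr01).
have pE : fine (p%:E)^-1%E = p^-1 by rewrite inver gt_eqF.
pose D := p * (C * (expR p^-1 / (expR p^-1 - 1))) `^ (p - 1) * C.
have D0 : 0 < D.
  rewrite !mulr_gt0// powR_gt0// mulr_gt0// divr_gt0 ?expR_gt0// subr_gt0.
  by rewrite expR_gt1 invr_gt0.
exists (D `^ p^-1); first by rewrite powR_gt0.
move=> K f B mB hB iB fB; rewrite /lacunary_exponent /= pE.
have S0 x : 0 <= \sum_(k < K) B k x.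
  by apply: sumr_ge0 => k _; have /andP[] := hB k x.
rewrite unlock -powRM ?(ltW D0)// -poweR_EFin.
apply: gt0_ler_poweR; rewrite ?in_itv/= ?invr_ge0 ?(ltW p0)//.
- by rewrite integral_ge0 ?leey// => x _; rewrite poweR_ge0.
- by rewrite lee_fin mulr_ge0 ?(ltW D0)//= leey.
apply: (@le_trans _ _ (\int[mu]_x ((\sum_(k < K) B k x) `^ p)%:E)%E).
  apply: ge0_le_integral_nonmeasurable => x; first by rewrite lee_fin powR_ge0.
  rewrite /= lee_fin; apply: ge0_ler_powR; rewrite ?nnegrE ?S0//.
  exact: ltW.
apply: integral_lacunary_le => //.
- by move=> k x; rewrite -pE.
- by move=> k; rewrite -pE.
Qed.

End lacunary_norm.

(** * Sums of Gaussians are Schwartz functions *)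

Section schwartz_gaussian.
Context {R : realType} {N : nat}.
Local Notation V := 'rV[R]_N.

(** Transfers the chain rule on the line to directional derivatives. *)
Lemma is_derive_line (f : V -> R) (x v : V) (df : R) :
  is_derive x v f df <-> is_derive (0 : R) (1 : R) (fun h : R => f (h *: v + x)) df.
Proof.
have E : (fun h : R => h^-1 *: (f (h *: v + x) - f x)) =
  (fun h : R => h^-1 *: (f ((h *: (1 : R) + 0) *: v + x) - f (0 *: v + x))).
  by apply/funext => h; rewrite scale0r add0r addr0 -[h *: 1]/(h * 1) mulr1.
split=> -[d1 d2]; apply: DeriveDef.
- by move: d1; rewrite /derivable E.
- by move: d2; rewrite /derive E.
- by move: d1; rewrite /derivable E.
- by move: d2; rewrite /derive E.
Qed.

(** Polynomial functions of the coordinates.  With a Gaussian factor they are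
    closed under all partial derivatives. *)
Inductive poly_fun : (V -> R) -> Prop :=
| poly_fun_cst c : poly_fun (fun=> c)
| poly_fun_coord i : poly_fun (fun x => x 0 i)
| poly_fun_add p q : poly_fun p -> poly_fun q -> poly_fun (fun x => p x + q x)
| poly_fun_mul p q : poly_fun p -> poly_fun q -> poly_fun (fun x => p x * q x).

Lemma poly_fun_sum (I : Type) (r : seq I) (F : I -> V -> R) :
  (forall i, poly_fun (F i)) -> poly_fun (fun x => \sum_(i <- r) F i x).
Proof.
move=> pF; elim: r => [|i r IH].
  under eq_fun do rewrite big_nil; exact: poly_fun_cst.
under eq_fun do rewrite big_cons; exact: poly_fun_add.
Qed.

Lemma poly_fun_exp p n : poly_fun p -> poly_fun (fun x => p x ^+ n).
Proof.
move=> pp; elim: n => [|n IH].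
  under eq_fun do rewrite expr0; exact: poly_fun_cst.
under eq_fun do rewrite exprS; exact: poly_fun_mul.
Qed.

Lemma poly_fun_prod (I : Type) (r : seq I) (F : I -> V -> R) :
  (forall i, poly_fun (F i)) -> poly_fun (fun x => \prod_(i <- r) F i x).
Proof.
move=> pF; elim: r => [|i r IH].
  under eq_fun do rewrite big_nil; exact: poly_fun_cst.
under eq_fun do rewrite big_cons; exact: poly_fun_mul.
Qed.

Lemma poly_fun_continuous p : poly_fun p -> continuous p.
Proof.
elim=> [c|i|f g _ cf _ cg|f g _ cf _ cg] x.
- exact: cst_continuous.
- exact: coord_continuous.
- by apply: cvgD; [exact: (@nbhs_filter V)|exact: cf|exact: cg].
- by apply: cvgM; [exact: (@nbhs_filter V)|exact: cf|exact: cg].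
Qed.

Lemma poly_fun_derive p (v : V) : poly_fun p ->
  exists2 dp, poly_fun dp & forall x, is_derive x v p (dp x).
Proof.
elim=> [c|i|f g pf [df pdf hf] pg [dg pdg hg]|f g pf [df pdf hf] pg [dg pdg hg]].
- exists (fun=> 0); first exact: poly_fun_cst.
  by move=> x; exact: is_derive_cst.
- exists (fun=> v 0 i); first exact: poly_fun_cst.
  move=> x; apply/is_derive_line.
  rewrite (_ : (fun h => _) = (fun h : R => v 0 i * h + x 0 i)).
    exact: is_derive_affine.
  by apply/funext => h; rewrite !mxE mulrC.
- exists (fun x => df x + dg x); first exact: poly_fun_add.
  by move=> x; exact: (is_deriveD (hf x) (hg x)).
- exists (fun x => f x * dg x + g x * df x).
    by apply: poly_fun_add; exact: poly_fun_mul.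
  by move=> x; exact: (is_deriveM (hf x) (hg x)).
Qed.

Definition sqr_norm (x : V) : R := \sum_(i < N) x 0 i ^+ 2.

Lemma sqr_norm_ge0 x : 0 <= sqr_norm x.
Proof. by apply: sumr_ge0 => i _; exact: sqr_ge0. Qed.

Lemma poly_fun_growth p : poly_fun p ->
  exists n, exists2 C : R, 0 < C & forall x, `|p x| <= C * (1 + sqr_norm x) ^+ n.
Proof.
have s1 x : 1 <= 1 + sqr_norm x by rewrite lerDl sqr_norm_ge0.
have s0 x n : 0 <= (1 + sqr_norm x) ^+ n.
  by rewrite exprn_ge0// addr_ge0 ?sqr_norm_ge0.
elim=> [c|i|f g _ [n [C C0 hC]] _ [m [D D0 hD]]|f g _ [n [C C0 hC]] _ [m [D D0 hD]]].
- exists 0%N, (`|c| + 1); first by rewrite ltr_wpDl.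
  by move=> x; rewrite expr0 mulr1 lerDl.
- exists 1%N, 1 => // x; rewrite mul1r expr1.
  have : x 0 i ^+ 2 <= sqr_norm x.
    by rewrite /sqr_norm (bigD1 i)//= lerDl sumr_ge0// => j _; exact: sqr_ge0.
  rewrite -[x 0 i ^+ 2]real_normK ?num_real//.
  have := normr_ge0 (x 0 i); nra.
- exists (n + m)%N, (C + D); first by rewrite addr_gt0.
  move=> x; apply: le_trans (ler_normD _ _) _; rewrite mulrDl; apply: lerD.
    apply: le_trans (hC x) _; rewrite ler_wpM2l ?(ltW C0)//.
    by rewrite ler_weXn2l// leq_addr.
  apply: le_trans (hD x) _; rewrite ler_wpM2l ?(ltW D0)//.
  by rewrite ler_weXn2l// leq_addl.
- exists (n + m)%N, (C * D); first by rewrite mulr_gt0.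
  move=> x; rewrite normrM exprD mulrACA; exact: ler_pM.
Qed.

Definition row_gaussian (a : 'I_N -> R) (x : V) : R :=
  expR (- (\sum_(i < N) a i * x 0 i ^+ 2) / 2).

Let exponent (a : 'I_N -> R) (x : V) : R := - (\sum_(i < N) a i * x 0 i ^+ 2) / 2.

Let poly_exponent a : poly_fun (exponent a).
Proof.
rewrite (_ : exponent a = fun x => (\sum_(i < N) a i * x 0 i ^+ 2) * (- 2^-1)); last first.
  by apply/funext => x; rewrite /exponent; ring.
apply: poly_fun_mul; last exact: poly_fun_cst.
apply: poly_fun_sum => i; apply: poly_fun_mul; first exact: poly_fun_cst.
by apply: poly_fun_exp; exact: poly_fun_coord.
Qed.

Lemma row_gaussian_continuous a : continuous (row_gaussian a).
Proof.
move=> x; apply: (@continuous_comp _ _ _ (exponent a) expR); last exact: continuous_expR.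
exact: poly_fun_continuous.
Qed.

Lemma row_gaussian_derive a (v : V) :
  exists2 dp, poly_fun dp &
    forall x, is_derive x v (row_gaussian a) (dp x * row_gaussian a x).
Proof.
have [dp pdp hdp] := poly_fun_derive _ v (poly_exponent a).
exists dp => // x; apply/is_derive_line.
rewrite -[X in is_derive _ _ X _]/(expR \o (fun h : R => exponent a (h *: v + x))).
rewrite mulrC; have -> : row_gaussian a x = expR (exponent a (0 *: v + x)).
  by rewrite scale0r add0r.
by apply: is_derive1_comp; apply/is_derive_line.
Qed.

(** The constant comes from the harmonic bound: each a i is at least the inverse of
    1 plus the sum of the inverses of all of them. *)
Lemma row_gaussian_decay a : (forall i, 0 < a i) ->
  exists2 c : R, 0 < c & forall x, row_gaussian a x <= expR (- (c * sqr_norm x)).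
Proof.
move=> a0; pose S := 1 + \sum_(i < N) (a i)^-1.
have S0 : 0 < S by rewrite ltr_pwDl// sumr_ge0// => i _; rewrite invr_ge0 ltW.
exists (S^-1 / 2); first by rewrite divr_gt0// invr_gt0.
move=> x; rewrite ler_expR.
rewrite (_ : - (S^-1 / 2 * sqr_norm x) = - (S^-1 * sqr_norm x) / 2); last by field; rewrite gt_eqF.
rewrite ler_wpM2r// lerN2 /sqr_norm mulr_sumr; apply: ler_sum => i _.
rewrite ler_wpM2r ?sqr_ge0// -[leRHS]invrK lef_pV2 ?posrE ?invr_gt0//.
rewrite /S (bigD1 i)//= addrCA lerDl addr_ge0// sumr_ge0// => j _.
by rewrite invr_ge0 ltW.
Qed.

Lemma poly_gaussian_bounded p a : poly_fun p -> (forall i, 0 < a i) ->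
  exists M : R, forall x, `|p x * row_gaussian a x| <= M.
Proof.
move=> pp a0; have [n [C C0 hC]] := poly_fun_growth _ pp.
have [c c0 hc] := row_gaussian_decay a a0.
have [D D0 hD] := expR_beats_power R n c c0.
exists (C * D) => x; rewrite normrM (ger0_norm (expR_ge0 _)).
apply: (@le_trans _ _ (C * (1 + sqr_norm x) ^+ n * expR (- (c * sqr_norm x)))).
  by apply: ler_pM; rewrite ?expR_ge0 ?hc.
by rewrite -mulrA ler_wpM2l ?(ltW C0)// hD// sqr_norm_ge0.
Qed.

Section gaussian_sum.
Variables (K : nat) (a : 'I_K -> 'I_N -> R).
Hypothesis a0 : forall k i, 0 < a k i.

(** Differentiating a polynomial times a Gaussian gives another such product,
    with the same Gaussian. *)
Lemma partials_gaussian_sum (s : seq 'I_N) :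
  exists2 p : 'I_K -> V -> R, (forall k, poly_fun (p k)) &
    partials s (fun x => \sum_(k < K) row_gaussian (a k) x) =
    (fun x => \sum_(k < K) p k x * row_gaussian (a k) x).
Proof.
elim: s => [|i s [p pp IH]].
  exists (fun _ _ => 1) => [k|]; first exact: poly_fun_cst.
  by apply/funext => x; apply: eq_bigr => k _; rewrite mul1r.
have /choice[dp hdp] : forall k, exists dp, poly_fun dp /\
    forall x, is_derive x (delta_mx 0 i : V) (p k) (dp x).
  by move=> k; have [q] := poly_fun_derive _ (delta_mx 0 i) (pp k); exists q.
have /choice[dg hdg] : forall k, exists dg, poly_fun dg /\
    forall x, is_derive x (delta_mx 0 i : V) (row_gaussian (a k))
      (dg x * row_gaussian (a k) x).
  by move=> k; have [q] := row_gaussian_derive (a k) (delta_mx 0 i); exists q.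
exists (fun k x => dp k x + p k x * dg k x).
  move=> k; apply: poly_fun_add; first by have [] := hdp k.
  by apply: poly_fun_mul => //; have [] := hdg k.
apply/funext => x; rewrite /= -/(partials s _) IH.
have dsum : is_derive x (delta_mx 0 i : V) (\sum_(k < K) (p k * row_gaussian (a k)))
   (\sum_(k < K) (dp k x + p k x * dg k x) * row_gaussian (a k) x).
  apply: is_derive_eq.
    apply: is_derive_sum => k.
    have [_ h1] := hdp k; have [_ h2] := hdg k.
    exact: (is_deriveM (h1 x) (h2 x)).
  apply: eq_bigr => k _; rewrite -![_ *: _]/(_ * _); ring.
have <- : \sum_(k < K) (p k * row_gaussian (a k)) =
    (fun x => \sum_(k < K) p k x * row_gaussian (a k) x).
  by apply/funext => y; rewrite fct_sumE.
exact: derive_val.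
Qed.

Lemma schwartz_real_gaussian_sum :
  schwartz_real (fun x => \sum_(k < K) row_gaussian (a k) x).
Proof.
split=> [s|e s]; have [p pp ->] := partials_gaussian_sum s.
  split=> [x|i x].
    elim: (index_enum _) => [|k r IH].
      by under eq_fun do rewrite big_nil; exact: cst_continuous.
    under eq_fun do rewrite big_cons.
    apply: cvgD; [exact: (@nbhs_filter V)| |exact: IH].
    apply: cvgM; [exact: (@nbhs_filter V)|exact: poly_fun_continuous|].
    exact: row_gaussian_continuous.
  rewrite (_ : (fun x => _) = \sum_(k < K) (p k * row_gaussian (a k))).
    apply: derivable_sum => k; apply: derivableM.
      by have [q _ /(_ x)[]] := poly_fun_derive _ (delta_mx 0 i) (pp k).
    by have [q _ /(_ x)[]] := row_gaussian_derive (a k) (delta_mx 0 i).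
  by apply/funext => y; rewrite fct_sumE.
have /choice[M hM] : forall k, exists M : R, forall x : V,
    `|((\prod_(i < N) x 0 i ^+ e i) * p k x) * row_gaussian (a k) x| <= M.
  move=> k; apply: (poly_gaussian_bounded (fun x : V => (\prod_(i < N) x 0 i ^+ e i) * p k x)) => //.
  apply: poly_fun_mul => //; apply: poly_fun_prod => i.
  by apply: poly_fun_exp; exact: poly_fun_coord.
exists (\sum_(k < K) M k) => x; rewrite mulr_sumr.
apply: le_trans (ler_norm_sum _ _ _) _; apply: ler_sum => k _.
by rewrite mulrA hM.
Qed.

End gaussian_sum.
End schwartz_gaussian.

(** * Fourier transforms and fractional derivatives of sums of Gaussians *)

Lemma big_tagnat (T : Type) (idx : T) (op : Monoid.com_law idx) (n : nat)
    (d : 'I_n -> nat) (F : 'I_(\sum_(k < n) d k) -> T) :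
  \big[op/idx]_i F i =
  \big[op/idx]_(l < n) \big[op/idx]_(k < d l) F (tagnat.Rank l k).
Proof.
rewrite sig_big_dep/= (reindex _ tagnat.sig_bij_on)/=.
by apply: eq_bigr => i _; rewrite -tagnat.rankE tagnat.sigK.
Qed.

Lemma sum_block (R : realType) (n : nat) (d : 'I_n -> nat) (j : 'I_n)
    (F : 'I_(\sum_(k < n) d k) -> R) :
  \sum_(i | tagnat.sig1 i == j) F i = \sum_(k < d j) F (tagnat.Rank j k).
Proof.
rewrite big_mkcond big_tagnat /= (bigD1 j)//= [X in _ + X]big1 ?addr0.
  by apply: eq_bigr => k _; rewrite tagnat.Rank1K eqxx.
move=> l lj; apply: big1 => k _; rewrite tagnat.Rank1K.
by rewrite (negbTE lj).
Qed.

Lemma euclid_submxrow (R : realType) (n : nat) (d : 'I_n -> nat) (j : 'I_n)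
    (t : (\sum_(k < n) d k).-tuple R) :
  euclid (submxrow (row_of_tuple t) j) =
  block_norm (fun i => tagnat.sig1 i == j) t.
Proof.
rewrite /euclid /dotp /block_norm sum_block; congr Num.sqrt.
by apply: eq_bigr => k _; rewrite !mxE expr2.
Qed.

Lemma normc_le (R : realType) (z : R[i]) :
  Normc.normc z <= `|complex.Re z| + `|complex.Im z|.
Proof.
case: z => x y /=; rewrite -(ger0_norm (addr_ge0 (normr_ge0 x) (normr_ge0 y))).
rewrite -sqrtr_sqr ler_wsqrtr// sqrrD !real_normK ?num_real//.
by rewrite -addrA lerD2l lerDr mulrn_wge0// mulr_ge0.
Qed.

Lemma Rintegral_sum d (T : measurableType d) (R : realType)
    (mu : {measure set T -> \bar R}) (I : Type) (r : seq I) (F : I -> T -> R) :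
  (forall i, mu.-integrable setT (EFin \o F i)) ->
  \int[mu]_x (\sum_(i <- r) F i x) = \sum_(i <- r) \int[mu]_x F i x.
Proof.
move=> intF.
have : forall s, mu.-integrable setT (EFin \o (fun x => \sum_(i <- s) F i x)) /\
    \int[mu]_x (\sum_(i <- s) F i x) = \sum_(i <- s) \int[mu]_x F i x.
  elim=> [|i s [IH1 IH2]].
    split.
      rewrite (_ : EFin \o _ = cst 0%E); first exact: integrable0.
      by apply/funext => x /=; rewrite big_nil.
    under eq_Rintegral do rewrite big_nil.
    by rewrite big_nil /Rintegral integral0.
  split.
    rewrite (_ : EFin \o _ = (fun x => (F i x)%:E + (\sum_(i <- s) F i x)%:E)%E).
      exact: (integrableD measurableT (intF i) IH1).
    by apply/funext => x /=; rewrite big_cons EFinD.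
  under eq_Rintegral do rewrite big_cons.
  by rewrite RintegralD// IH2 big_cons.
by move=> /(_ r)[].
Qed.

Section fourier_gaussian.
Context {R : realType} {N : nat}.

Lemma row_gaussian_row_of_tuple (a : 'I_N -> R) (t : N.-tuple R) :
  row_gaussian a (row_of_tuple t) = gaussian a t.
Proof.
rewrite /row_gaussian /gaussian; congr expR; congr (- _ / _).
by apply: eq_bigr => i _; rewrite mxE.
Qed.

Lemma dotp_row_of_tupler (x : 'rV[R]_N) (t : N.-tuple R) :
  dotp x (row_of_tuple t) = pairing (x 0) t.
Proof. by apply: eq_bigr => i _; rewrite mxE. Qed.

Lemma dotpC (x y : 'rV[R]_N) : dotp x y = dotp y x.
Proof. by apply: eq_bigr => i _; rewrite mulrC. Qed.

Definition fourier_factor : R := (2 * pi) `^ (- (N%:R / 2)).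

Lemma fourier_factor_gt0 : 0 < fourier_factor.
Proof. by rewrite powR_gt0// mulr_gt0// pi_gt0. Qed.

(** The normalisation splits as one factor (2 pi)^(-1/2) per coordinate. *)
Lemma fourier_factor_prod (a : 'I_N -> R) (y : 'I_N -> R) : (forall i, 0 < a i) ->
  fourier_factor * \prod_(i < N) (Num.sqrt (2 * pi / a i) * y i) =
  \prod_(i < N) (Num.sqrt (a i))^-1 * \prod_(i < N) y i.
Proof.
move=> a0; have pp : 0 < 2 * pi :> R by rewrite mulr_gt0// pi_gt0.
have -> : fourier_factor = \prod_(i < N) (Num.sqrt (2 * pi))^-1.
  rewrite prodr_const card_ord /fourier_factor powRN exprVn; congr (_^-1).
  by rewrite (mulrC N%:R) powRrM powR12_sqrt ?(ltW pp)// powR_mulrn ?sqrtr_ge0.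
rewrite -!big_split; apply: eq_bigr => i _ /=.
move: (2 * pi) pp => S pp; rewrite sqrtrM ?(ltW pp)// mulrA; congr (_ * _).
by rewrite mulrA mulVf ?mul1r ?sqrtrV ?(ltW (a0 i))// gt_eqF// sqrtr_gt0.
Qed.

Variables (K : nat) (a : 'I_K -> 'I_N -> R).
Hypothesis a0 : forall k i, 0 < a k i.

Definition gaussian_sum (x : 'rV[R]_N) : R[i] :=
  (\sum_(k < K) row_gaussian (a k) x)%:C%C.

Lemma schwartz_gaussian_sum : schwartz gaussian_sum.
Proof.
split; first exact: schwartz_real_gaussian_sum.
(* The imaginary part 0 is an empty sum of Gaussians. *)
have [h1 h2] := @schwartz_real_gaussian_sum R N 0 (fun _ _ => 1) (fun _ _ => ltr01).
rewrite (_ : (fun x => _) = (fun x : 'rV[R]_N => \sum_(k < 0) row_gaussian (fun=> 1) x)).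
  by [].
by apply/funext => x; rewrite big_ord0.
Qed.

Definition gaussian_sum_hat (xi : 'rV[R]_N) : R :=
  \sum_(k < K) \prod_(i < N) (Num.sqrt (a k i))^-1 *
     row_gaussian (fun i => (a k i)^-1) xi.

Lemma Rintegral_gaussian_sum_cos (x : 'I_N -> R) (u : R) :
  \int[lebesgue_tuple R N]_t
    ((\sum_(k < K) gaussian (a k) t) * cos (pairing x t + u)) =
  cos u * \sum_(k < K) \prod_(i < N)
    (Num.sqrt (2 * pi / a k i) * expR (- ((a k i)^-1 * x i ^+ 2) / 2)).
Proof.
under eq_Rintegral do rewrite mulr_suml.
rewrite Rintegral_sum; last by move=> k; exact: integrable_ngaussian_cos.
rewrite mulr_sumr; apply: eq_bigr => k _.
by rewrite /Rintegral integral_ngaussian_cos.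
Qed.

(** The real and imaginary parts are the phases 0 and pi/2; the second one
    vanishes since cos (pi/2) = 0. *)
Lemma fourier_gaussian_sum xi :
  fourier gaussian_sum xi = (gaussian_sum_hat xi)%:C%C.
Proof.
rewrite /fourier /fourier_cst -/fourier_factor /cintegral_rV /integral_rV.
have re : \int[lebesgue_tuple R N]_t complex.Re
    (gaussian_sum (row_of_tuple t) * expi (- dotp (row_of_tuple t) xi)) =
   \sum_(k < K) \prod_(i < N)
    (Num.sqrt (2 * pi / a k i) * expR (- ((a k i)^-1 * xi 0 i ^+ 2) / 2)).
  transitivity (\int[lebesgue_tuple R N]_t
    ((\sum_(k < K) gaussian (a k) t) * cos (pairing (xi 0) t + 0))).
    apply: eq_Rintegral => t _; rewrite /gaussian_sum /= mul0r subr0 addr0.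
    rewrite dotpC dotp_row_of_tupler cosN; congr (_ * _).
    by apply: eq_bigr => k _; rewrite row_gaussian_row_of_tuple.
  by rewrite Rintegral_gaussian_sum_cos cos0 mul1r.
have im : \int[lebesgue_tuple R N]_t complex.Im
    (gaussian_sum (row_of_tuple t) * expi (- dotp (row_of_tuple t) xi)) = 0.
  transitivity (\int[lebesgue_tuple R N]_t
    ((\sum_(k < K) gaussian (a k) t) * cos (pairing (xi 0) t + pi / 2))).
    apply: eq_Rintegral => t _; rewrite /gaussian_sum /= mul0r addr0.
    rewrite dotpC dotp_row_of_tupler sinN cosDpihalf; congr (_ * _).
    by apply: eq_bigr => k _; rewrite row_gaussian_row_of_tuple.
  by rewrite Rintegral_gaussian_sum_cos cos_pihalf mul0r.
rewrite re im; apply/eqP; rewrite eq_complex /= !mul0r !mulr0 subr0 addr0 !eqxx andbT.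
apply/eqP; rewrite /gaussian_sum_hat mulr_sumr; apply: eq_bigr => k _.
rewrite fourier_factor_prod//; congr (_ * _).
by rewrite /row_gaussian -expR_sum; congr expR; rewrite -mulr_suml sumrN.
Qed.

End fourier_gaussian.

Section fracD_gaussian.
Context {R : realType} {n : nat} (d : 'I_n -> nat).
Local Notation N := (\sum_(k < n) d k)%N.
Variables (j : 'I_n) (s : R).
Hypothesis s0 : 0 < s.
Let P : pred 'I_N := fun i => tagnat.sig1 i == j.

Lemma Rintegral_fractional_sum (K : nat) (a : 'I_K -> 'I_N -> R) (b : 'I_K -> R)
    (x : 'I_N -> R) (u : R) :
  (forall k i, 0 < a k i) -> (forall k, 0 < b k) ->
  (forall k i, P i -> a k i = b k) ->
  \int[lebesgue_tuple R N]_t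
    (block_norm P t `^ s * gaussian_sum_hat K a (row_of_tuple t) *
       cos (pairing x t + u)) =
  \sum_(k < K) \prod_(i < N) (Num.sqrt (a k i))^-1 *
    \int[lebesgue_tuple R N]_t fractional_integrand P s (a k) x u t.
Proof.
move=> a0 b0 aP.
have intk k := integrable_fractional_integrand R N P s (b k) (a k) x u s0 (b0 k) (a0 k) (aP k).
transitivity (\int[lebesgue_tuple R N]_t (\sum_(k < K)
   (\prod_(i < N) (Num.sqrt (a k i))^-1 * fractional_integrand P s (a k) x u t))).
  apply: eq_Rintegral => t _; rewrite /gaussian_sum_hat mulr_sumr mulr_suml.
  apply: eq_bigr => k _; rewrite row_gaussian_row_of_tuple /fractional_integrand.
  by ring.
rewrite Rintegral_sum; last first.
  by move=> k; exact: (integrableZl measurableT _ (intk k)).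
by apply: eq_bigr => k _; rewrite RintegralZl.
Qed.

(** The imaginary part is the integral with phase - pi/2. *)
Lemma fracD_gaussian_sum_normc (K : nat) (a : 'I_K -> 'I_N -> R)
    (x : N.-tuple R) :
  (forall k i, 0 < a k i) ->
  Normc.normc (fracD j s (gaussian_sum K a) (row_of_tuple x)) <=
  fourier_factor (R := R) (N := N) *
  (`|\int[lebesgue_tuple R N]_t
      (block_norm P t `^ s * gaussian_sum_hat K a (row_of_tuple t) *
       cos (pairing (tnth x) t + 0))| +
   `|\int[lebesgue_tuple R N]_t
      (block_norm P t `^ s * gaussian_sum_hat K a (row_of_tuple t) *
       cos (pairing (tnth x) t + (- (pi / 2))))|).
Proof.
move=> a0; rewrite /fracD /fourier_inv /fourier_cst -/fourier_factor.
have fE : fourier (gaussian_sum K a) = fun xi => (gaussian_sum_hat K a xi)%:C%C.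
  by apply/funext => xi; rewrite fourier_gaussian_sum.
rewrite fE; apply: le_trans (normc_le _ _) _.
rewrite /cintegral_rV /integral_rV /=.
have dE (t : N.-tuple R) : dotp (row_of_tuple x) (row_of_tuple t) = pairing (tnth x) t.
  by rewrite dotp_row_of_tupler; apply: eq_bigr => i _; rewrite mxE.
rewrite !mul0r subr0 addr0 !normrM (ger0_norm (ltW fourier_factor_gt0)) -mulrDr.
rewrite ler_wpM2l ?(ltW fourier_factor_gt0)//.
apply: lerD; rewrite le_eqVlt; apply/orP; left; apply/eqP; apply: (congr1 Num.norm).
  apply: eq_Rintegral => t _; rewrite !mul0r !mulr0 !subr0 !addr0 mul0r subr0.
  by rewrite dE euclid_submxrow.
apply: eq_Rintegral => t _; rewrite !mul0r !mulr0 ?subr0 !addr0 ?mul0r ?addr0.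
by rewrite dE cosBpihalf euclid_submxrow.
Qed.

(** The Jacobian factor of the Fourier transform of each Gaussian cancels the
    factor in [fractional_gaussian_bound].  What is left says how much the k-th
    Gaussian contributes to the derivative in sup norm and in L^1. *)
Lemma fracD_gaussian_sum_bound :
  exists2 C : R, 0 < C & forall (a : nat -> 'I_N -> R) (b : nat -> R),
    (forall k i, 0 < a k i) -> (forall k, 0 < b k) ->
    (forall k i, tagnat.sig1 i = j -> a k i = b k) ->
    exists B : nat -> N.-tuple (measurableTypeR R) -> R,
    [/\ forall k, measurable_fun setT (B k),
        forall k x, 0 <= B k x <= C * b k `^ (s / 2),
        forall k, (\int[lebesgue_tuple R N]_x (B k x)%:E <=
          (C * b k `^ (s / 2) * \prod_(i < N) (Num.sqrt (a k i))^-1)%:E)%E &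
        forall (K : nat) x,
          Normc.normc (fracD j s (gaussian_sum K (fun k => a k)) (row_of_tuple x))
          <= \sum_(k < K) B k x].
Proof.
have [C C0 hC] := fractional_gaussian_bound R N P s s0.
have f0 : 0 < fourier_factor (R := R) (N := N) by exact: fourier_factor_gt0.
pose D := fourier_factor (R := R) (N := N) * (2 * C).
have D0 : 0 < D by rewrite !mulr_gt0.
exists (D * C); first by rewrite mulr_gt0.
move=> a b a0 b0 ab.
have aP k i : P i -> a k i = b k by move=> /eqP; exact: ab.
have /choice[W hW] : forall k, exists W : N.-tuple (measurableTypeR R) -> R,
   [/\ measurable_fun setT W, forall x, 0 <= W x <= C,
       (\int[lebesgue_tuple R N]_x (W x)%:E <=
             (C * \prod_(i < N) (Num.sqrt (a k i))^-1)%:E)%E &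
       forall x u,
            `|\int[lebesgue_tuple R N]_t fractional_integrand P s (a k) (tnth x) u t| <=
            C * b k `^ (s / 2) * \prod_(i < N) Num.sqrt (a k i) * W x].
  by move=> k; apply: hC => // i; exact: aP.
have Db k : 0 <= D * b k `^ (s / 2) by rewrite mulr_ge0 ?powR_ge0// ltW.
exists (fun k x => D * b k `^ (s / 2) * W k x); split.
- by move=> k; have [mW _ _ _] := hW k; exact: measurable_funM.
- move=> k x; have [_ /(_ x)/andP[W0 W1] _ _] := hW k.
  by rewrite mulr_ge0//= (mulrAC D C) ler_wpM2l.
- move=> k; have [mW W01 iW _] := hW k.
  under eq_integral do rewrite EFinM.
  rewrite ge0_integralZl//; last 3 first.
  - by apply/measurable_EFinP.
  - by move=> x _; rewrite lee_fin; have /andP[] := W01 x.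
  - by rewrite lee_fin.
  apply: (@le_trans _ _ ((D * b k `^ (s / 2))%:E *
    (C * \prod_(i < N) (Num.sqrt (a k i))^-1)%:E)%E).
    by apply: lee_wpmul2l => //; rewrite lee_fin.
  by rewrite -EFinM lee_fin mulrA (mulrAC D C).
- move=> K x; apply: le_trans (fracD_gaussian_sum_normc _ _ _ _) _ => //.
  have key u : `|\int[lebesgue_tuple R N]_t
      (block_norm P t `^ s * gaussian_sum_hat K (fun k => a k) (row_of_tuple t) *
       cos (pairing (tnth x) t + u))| <= \sum_(k < K) C * b k `^ (s / 2) * W k x.
    rewrite (Rintegral_fractional_sum _ _ (fun k => b k))//; last first.
      by move=> k i; exact: aP.
    apply: le_trans (ler_norm_sum _ _ _) _; apply: ler_sum => k _.
    have [_ _ _ /(_ x u) h] := hW k.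
    have q0 : 0 <= \prod_(i < N) (Num.sqrt (a k i))^-1.
      by apply: prodr_ge0 => i _; rewrite invr_ge0 sqrtr_ge0.
    rewrite normrM (ger0_norm q0); apply: le_trans (ler_wpM2l q0 h) _.
    rewrite !mulrA (mulrC _ C) -!mulrA; rewrite le_eqVlt; apply/orP; left; apply/eqP.
    congr (C * _); rewrite mulrCA; congr (_ * _); rewrite mulrA -big_split /=.
    rewrite big1 ?mul1r// => i _; rewrite mulVf// gt_eqF// sqrtr_gt0//.
  apply: (@le_trans _ _ (fourier_factor (R := R) (N := N) *
    (\sum_(k < K) C * b k `^ (s / 2) * W k x + \sum_(k < K) C * b k `^ (s / 2) * W k x))).
    by rewrite ler_wpM2l ?(ltW f0)// lerD ?key.
  rewrite -big_split mulr_sumr le_eqVlt; apply/orP; left; apply/eqP.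
  by apply: eq_bigr => k _; rewrite /D /=; ring.
Qed.

End fracD_gaussian.

(** * The supremum norm of a sum of Gaussians *)

Definition box {R : realType} (N : nat) (I : set R) : set (N.-tuple (measurableTypeR R)) :=
  [set t | forall i, I (tnth t i)].

Lemma measurable_box (R : realType) (N : nat) (I : set (measurableTypeR R)) :
  measurable I -> measurable (box N I).
Proof.
move=> mI; rewrite (_ : box N I = \bigcap_(i in [set: 'I_N])
    ((fun t : N.-tuple (measurableTypeR R) => tnth t i) @^-1` I)).
  apply: fin_bigcap_measurable => // i _; rewrite -[X in measurable X]setTI.
  exact: (@measurable_tnth _ (measurableTypeR R) N i).
by apply/seteqP; split=> [t ht i _|t ht i]; [exact: ht|exact: (ht i)].
Qed.

(** The measure of a box is the product of the measures of its sides. *)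
Lemma lebesgue_box_gt0 (R : realType) (N : nat) (I : set (measurableTypeR R)) :
  measurable I -> (0 < @lebesgue_measure R I)%E ->
  (0 < lebesgue_tuple R N (box N I))%E.
Proof.
move=> mI I0; elim: N => [|N IH].
  by rewrite /= diracE mem_set// => -[].
rewrite /= /lebesgue_cons /pushforward.
rewrite (_ : _ @^-1` _ = I `*` box N I); last first.
  apply/seteqP; split=> [[x t] /= h|[x t] /= [Ix ht] i].
    split; first by have := h ord0; rewrite tnth0.
    by move=> i; have := h (lift ord0 i); rewrite tnthS.
  by case: (unliftP ord0 i) => [k ->|->]; rewrite ?tnthS// tnth0.
rewrite product_measure1E//; last exact: measurable_box.
by rewrite mule_gt0.
Qed.

(** All the Gaussians are close to 1 near the origin. *)
Lemma gaussian_sum_lower (R : realType) (N K : nat) (a : 'I_K -> 'I_N -> R) :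
  (forall k i, 0 < a k i) ->
  exists2 r : R, 0 < r & forall t : N.-tuple R, (forall i, `|tnth t i| < r) ->
    K%:R / 2 <= Normc.normc (gaussian_sum K a (row_of_tuple t)).
Proof.
(* On |t_i| < 1 / S every exponent is at least - 1 / 2, as S >= 1. *)
move=> a0; pose S := 1 + \sum_(k < K) \sum_(i < N) a k i.
have T0 : 0 <= \sum_(k < K) \sum_(i < N) a k i.
  by apply: sumr_ge0 => k _; apply: sumr_ge0 => i _; exact: ltW.
have S1 : 1 <= S by rewrite lerDl.
have S0 : 0 < S by rewrite (lt_le_trans ltr01).
exists S^-1; first by rewrite invr_gt0.
move=> t ht; rewrite /= expr0n addr0 sqrtr_sqr ger0_norm; last first.
  by apply: sumr_ge0 => k _; exact: expR_ge0.
rewrite -mulr_natl mulr1 -[in leLHS](card_ord K).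
rewrite [leLHS](_ : _ = \sum_(k < K) 2^-1); last first.
  by rewrite sumr_const card_ord mulr_natl.
apply: ler_sum => k _; rewrite row_gaussian_row_of_tuple.
apply: le_trans (expR_ge1Dx _).
rewrite -lerBlDl (_ : 2^-1 - 1 = - 1 / 2); last by field.
rewrite ler_wpM2r// lerN2.
apply: (@le_trans _ _ (\sum_(i < N) a k i * S^-1)).
  apply: ler_sum => i _; rewrite ler_wpM2l ?(ltW (a0 k i))//.
  rewrite -[tnth t i ^+ 2]real_normK ?num_real// expr2.
  apply: (@le_trans _ _ (S^-1 * S^-1)).
    by apply: ler_pM => //; rewrite ltW.
  by rewrite ler_piMr ?invr_ge0 ?(ltW S0)// invf_le1.
rewrite -mulr_suml ler_pdivrMr// mul1r /S (bigD1 k)//= addrCA lerDl.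
rewrite addr_ge0// sumr_ge0// => l _; apply: sumr_ge0 => i _; exact: ltW.
Qed.

(** The lower bound holds on a box of positive measure, hence is seen by the
    essential supremum. *)
Lemma Lp_norm_gaussian_sum_ge (R : realType) (N K : nat) (a : 'I_K -> 'I_N -> R) :
  (forall k i, 0 < a k i) ->
  ((K%:R / 2)%:E <= Lp_norm +oo (gaussian_sum K a))%E.
Proof.
move=> a0; have [r r0 hr] := gaussian_sum_lower R N K a a0.
pose I : set (measurableTypeR R) := `]- r, r[%classic.
have mI : measurable I by exact: measurable_itv.
have I0 : (0 < @lebesgue_measure R I)%E.
  rewrite lebesgue_measure_itv/= lte_fin gtrN// -EFinD lte_fin.
  by rewrite opprK addr_gt0.
have B0 := lebesgue_box_gt0 R N I mI I0.
have mB := measurable_box R N I mI.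
rewrite /Lp_norm unlock ifT; last first.
  apply: lt_le_trans B0 _; apply: le_measure; rewrite ?inE//.
rewrite leNgt; apply/negP => lt.
have [Z [mZ Z0 hZ]] := ess_sup_ge (lebesgue_tuple R N)
  (abse \o (fun t => (Normc.normc (gaussian_sum K a (row_of_tuple t)))%:E)).
have BZ : box N I `<=` Z.
  move=> t Bt; apply: hZ => /= h.
  have := le_lt_trans h lt; rewrite lte_fin ltNge => /negP; apply.
  apply: le_trans (ler_norm _); apply: hr => i.
  by have := Bt i; rewrite /I /= in_itv/= ltr_norml.
have : (lebesgue_tuple R N (box N I) <= lebesgue_tuple R N Z)%E.
  by apply: le_measure; rewrite ?inE.
by rewrite Z0 leNgt B0.
Qed.

(** * Dilated Gaussians and the failure of the inequality *)

Lemma prode_le (R : realType) (I : Type) (r : seq I) (x : I -> \bar R) (y : I -> R) :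
  (forall i, 0 <= x i <= (y i)%:E)%E ->
  (0 <= \prod_(i <- r) x i <= (\prod_(i <- r) y i)%:E)%E.
Proof.
move=> h; elim: r => [|i r /andP[IH1 IH2]]; first by rewrite !big_nil lexx lee_fin ler01.
have /andP[x0 xy] := h i.
rewrite !big_cons EFinM mule_ge0//=; exact: lee_pmul.
Qed.

Lemma prod_powR (R : realType) (I : Type) (r : seq I) (x : R) (f : I -> R) :
  0 < x -> \prod_(i <- r) x `^ f i = x `^ (\sum_(i <- r) f i).
Proof.
move=> x0; elim: r => [|i r IH]; first by rewrite !big_nil powRr0.
by rewrite !big_cons IH powRD// (gt_eqF x0) implybT.
Qed.

Lemma fine_inve_ge0 (R : realType) (p : \bar R) : (1 <= p)%E -> 0 <= fine p^-1%E.
Proof.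
case: p => [p| |]//; rewrite lee_fin => p1.
by rewrite inver gt_eqF ?(lt_le_trans ltr01 p1)//= invr_ge0 (le_trans ler01 p1).
Qed.

Lemma lacunary_exponent_le1 (R : realType) (p : \bar R) : (1 <= p)%E ->
  lacunary_exponent p <= 1.
Proof.
rewrite /lacunary_exponent; case: p => [p| |]//; rewrite lee_fin => p1 /=.
by rewrite inver gt_eqF ?(lt_le_trans ltr01 p1)//= invf_le1 ?(lt_le_trans ltr01 p1).
Qed.

Lemma lacunary_exponent_lt1 (R : realType) (p : \bar R) : (1 < p < +oo)%E ->
  lacunary_exponent p < 1.
Proof.
rewrite /lacunary_exponent; case: p => [p| |]//; rewrite ?andbF// lte_fin => /andP[p1 _] /=.
by rewrite inver gt_eqF ?(lt_trans ltr01 p1)//= invf_lt1 ?(lt_trans ltr01 p1).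
Qed.

Section dilated_gaussians.
Context {R : realType} {n : nat} (d : 'I_n -> nat) (s : 'I_n -> R) (p : 'I_n -> \bar R).
Local Notation N := (\sum_(k < n) d k)%N.
Hypotheses (s0 : forall j, 0 < s j) (p1 : forall j, (1 <= p j)%E).
Let c j := fine (p j)^-1%E / s j.
Hypothesis dc : \sum_(j < n) (d j)%:R * c j = 1.

(** The coefficients of the k-th dilate: the block l is dilated by
    exp (k / (p_l s_l)), with the convention 1 / oo = 0. *)
Definition dilation_coef (k : nat) (i : 'I_N) : R :=
  expR (2 * (k%:R * c (tagnat.sig1 i))).

Lemma dilation_coef_gt0 k i : 0 < dilation_coef k i.
Proof. exact: expR_gt0. Qed.

(** This is where the normalisation of the group, Jacobian exp k at step k,
    enters. *)
Lemma dilation_jacobian k :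
  \prod_(i < N) (Num.sqrt (dilation_coef k i))^-1 = expR (- k%:R).
Proof.
rewrite (eq_bigr (fun i => expR (- (k%:R * c (tagnat.sig1 i))))); last first.
  move=> i _; rewrite expRN; congr (_^-1).
  by rewrite /dilation_coef -[2]/(2%:R) expRM_natl sqrtr_sqr ger0_norm ?expR_ge0.
rewrite -expR_sum; congr expR; rewrite sumrN -mulr_sumr big_tagnat/=.
rewrite -[RHS]mulr1 mulNr -dc; congr (- (_ * _)); apply: eq_bigr => l _.
under eq_bigr do rewrite tagnat.Rank1K.
by rewrite sumr_const card_ord mulr_natl.
Qed.

(** The k-th dilate contributes exp (k / p_j) in sup norm and exp (k / p_j - k) in
    L^1: the hypotheses of [Lnorm_lacunary_le]. *)
Lemma dilation_fracD j :
  exists2 D : R, 0 < D & forall K : nat,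
    (Lp_norm (p j) (fracD j (s j) (gaussian_sum K (fun k => dilation_coef k)))
      <= (D * K%:R `^ lacunary_exponent (p j))%:E)%E.
Proof.
have [C C0 hC] := fracD_gaussian_sum_bound d j (s j) (s0 j).
pose b (k : nat) := expR (2 * (k%:R * c j)).
have b0 k : 0 < b k by exact: expR_gt0.
have ab k i : tagnat.sig1 i = j -> dilation_coef k i = b k.
  by move=> h; rewrite /dilation_coef h.
have [B [mB hB iB fB]] := hC dilation_coef b dilation_coef_gt0 b0 ab.
have bE k : b k `^ (s j / 2) = expR (k%:R * fine (p j)^-1%E).
  rewrite /b /powR gt_eqF ?expR_gt0// expRK; congr expR.
  by rewrite /c; field; rewrite gt_eqF.
have [D D0 hD] := Lnorm_lacunary_le _ _ R (lebesgue_tuple R N) (p j) C (p1 j) C0.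
exists D => // K; apply: (hD K _ B mB).
- by move=> k x; rewrite -bE; exact: hB.
- by move=> k; rewrite expRD mulrA -bE -dilation_jacobian.
- by move=> x; rewrite ger0_norm//; case: (fracD _ _ _ _) => y z /=; rewrite sqrtr_ge0.
Qed.

End dilated_gaussians.

Theorem theorem1p7 (R : realType) (n : nat) (d : 'I_n -> nat) (s : 'I_n -> R)
    (p : 'I_n.+1 -> \bar R) (q : \bar R) (theta : 'I_n.+1 -> R)
    (hn : (2 <= n)%N)
    (hd : forall j, (0 < d j)%N)
    (hs : forall j, 0 <= s j)
    (hp : forall j, (1 <= p j)%E)
    (hq : (1 <= q)%E)
    (htheta : forall j, 0 <= theta j)
    (hp0q : p ord0 <> q)
    (hsum : \sum_(j < n.+1) theta j = 1)
    (hscale : forall j : 'I_n,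
      (d j)%:R * (\sum_(l < n.+1) theta l * fine (p l)^-1%E - fine q^-1%E)
      = theta (lift ord0 j) * s j)
    (hend : (theta ord0, q) = (0, +oo%E))
    (hj0 : exists j0 : 'I_n, (1 < p (lift ord0 j0) < +oo)%E /\
      0 < theta (lift ord0 j0)) :
  ~ exists C : R, forall u : 'rV[R]_(\sum_(j < n) d j) -> R[i], schwartz u ->
      (Lp_norm q u <=
       C%:E * (poweR (Lp_norm (p ord0) u) (theta ord0) *
         \prod_(j < n) poweR (Lp_norm (p (lift ord0 j)) (fracD j (s j) u))
                             (theta (lift ord0 j))))%E.
Proof.
have [theta00 qoo] : theta ord0 = 0 /\ q = +oo%E by case: hend.
pose p' (j : 'I_n) := p (lift ord0 j); pose th (j : 'I_n) := theta (lift ord0 j).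
have thsum : \sum_(j < n) th j = 1.
  by move: hsum; rewrite big_ord_recl theta00 add0r.
pose alpha := \sum_(j < n) th j * fine (p' j)^-1%E.
have hscale' j : (d j)%:R * alpha = th j * s j.
  rewrite -hscale qoo big_ord_recl theta00 mul0r add0r.
  by rewrite (_ : (+oo^-1)%E = 0%E)//= subr0.
have pi0 j : 0 <= fine (p' j)^-1%E by apply: fine_inve_ge0; exact: hp.
case: hj0 => j0 [pj0 tj0].
have alpha0 : 0 < alpha.
  rewrite /alpha (bigD1 j0)//= ltr_pwDl//.
    rewrite mulr_gt0//; move: pj0; rewrite /p'.
    case: (p _) => [r| |]//; rewrite ?andbF// lte_fin => /andP[r1 _].
    have r0 := lt_trans ltr01 r1.
    by rewrite inver gt_eqF//= invr_gt0.
  by apply: sumr_ge0 => l _; rewrite mulr_ge0// htheta.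
have ths0 j : 0 < th j * s j by rewrite -hscale' mulr_gt0// ltr0n.
have s0 j : 0 < s j.
  by rewrite lt_neqAle hs eq_sym andbT; apply: contraTneq (ths0 j) => ->; rewrite mulr0 ltxx.
(* By the scaling relation d_j / s_j = theta_j / alpha. *)
have dc : \sum_(j < n) (d j)%:R * (fine (p' j)^-1%E / s j) = 1.
  rewrite (eq_bigr (fun j => th j * fine (p' j)^-1%E / alpha)).
    by rewrite -mulr_suml mulfV// gt_eqF.
  move=> j _; have := hscale' j => h.
  have -> : (d j)%:R = th j * s j / alpha by rewrite -h mulfK// gt_eqF.
  by field; rewrite !gt_eqF.
move=> [C hC].
have hp' j : (1 <= p' j)%E by exact: hp.
have /choice[D hD] : forall j, exists D : R, 0 < D /\ forall K : nat,
    (Lp_norm (p' j) (fracD j (s j) (gaussian_sum K (fun k => dilation_coef d s p' k)))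
      <= (D * K%:R `^ lacunary_exponent (p' j))%:E)%E.
  by move=> j; have [D D0 h] := dilation_fracD d s p' s0 hp' dc j; exists D.
pose e := \sum_(j < n) th j * lacunary_exponent (p' j).
have e1 : e < 1.
  rewrite -thsum /e (bigD1 j0)//= [ltRHS](bigD1 j0)//=; apply: ltr_leD.
    by rewrite gtr_pMr// lacunary_exponent_lt1.
  by apply: ler_sum => j _; rewrite ler_piMr ?htheta// lacunary_exponent_le1.
pose H := 2 * (`|C| * \prod_(j < n) D j `^ th j).
have DK (K : nat) : (0 < K)%N -> \prod_(j < n) (D j * K%:R `^ lacunary_exponent (p' j)) `^ th j =
    (\prod_(j < n) D j `^ th j) * K%:R `^ e.
  move=> K0; rewrite (eq_bigr (fun j => D j `^ th j * K%:R `^ (th j * lacunary_exponent (p' j)))).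
    by rewrite big_split /= prod_powR// ltr0n.
  move=> j _; have [D0 _] := hD j.
  by rewrite powRM ?powR_ge0 ?(ltW D0)// -powRrM (mulrC (lacunary_exponent _)).
have bound (K : nat) : (0 < K)%N -> K%:R <= H * K%:R `^ e.
  move=> K0.
  have a0 (k : 'I_K) i : 0 < dilation_coef d s p' k i by exact: dilation_coef_gt0.
  have := hC _ (schwartz_gaussian_sum K _ a0).
  rewrite qoo theta00 poweRe0 mul1e => h.
  have {h} := le_trans (Lp_norm_gaussian_sum_ge R _ K _ a0) h.
  set X := (\prod_(j < n) _)%E => h.
  have /andP[X0 X1] : (0 <= X <= (\prod_(j < n)
      (D j * K%:R `^ lacunary_exponent (p' j)) `^ th j)%:E)%E.
    apply: prode_le => j; have [D0 /(_ K) hK] := hD j.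
    rewrite poweR_ge0/= -poweR_EFin; apply: gt0_ler_poweR => //.
    - by rewrite in_itv/= leey andbT Lnorm_ge0.
    - by rewrite in_itv/= leey andbT lee_fin mulr_ge0 ?powR_ge0// ltW.
  have {}h : ((K%:R / 2)%:E <= `|C|%:E * X)%E.
    apply: le_trans h _; apply: lee_wpmul2r => //.
    by rewrite lee_fin ler_norm.
  have {}h := le_trans h (lee_wpmul2l _ X1).
  have {h} := h (ltac:(by rewrite lee_fin)).
  rewrite -EFinM lee_fin DK// ler_pdivrMr// => h; apply: le_trans h _.
  by rewrite /H le_eqVlt; apply/orP; left; apply/eqP; ring.
have H0 : 0 <= H.
  by rewrite !mulr_ge0// prodr_ge0// => j _; exact: powR_ge0.
have e10 : 0 < 1 - e by rewrite subr_gt0.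
(* Any K above x has K^(1 - e) > H + 1, against the bound K^(1 - e) <= H. *)
pose x := (H + 1) `^ (1 - e)^-1.
have x0 : 0 <= x by exact: powR_ge0.
have Kx := archi_boundP x0; set K := Num.bound x in Kx.
have K0 : 0 < K%:R :> R by exact: le_lt_trans Kx.
have : H + 1 < K%:R `^ (1 - e).
  have -> : H + 1 = x `^ (1 - e).
    by rewrite /x -powRrM mulVf ?powRr1 ?addr_ge0// gt_eqF.
  by apply: gt0_ltr_powR; rewrite ?nnegrE ?(ltW K0).
rewrite ltNge => /negP; apply.
rewrite powRB ?(gt_eqF K0) ?implybT// powRr1 ?(ltW K0)//.
rewrite ler_pdivrMr ?powR_gt0//; apply: le_trans (bound K _) _; first by rewrite -(ltr0n R).
by rewrite ler_wpM2r ?powR_ge0// lerDl.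
Qed.
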